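(* There exists a deterministic $O(\log n)$-competitive online algorithm for facility location with delay, where $n$ is the number of vertices of the input graph.
   Context: Facility location with delay: given in advance a graph $G=(V,E)$ with $|V|=n$, facility opening costs $f:V\to\mathbb{R}^+$ and edge weights $w:E\to\mathbb{R}^+$; let $\delta$ be the shortest-path metric on $V$ induced by $w$. Requests arrive over time, each request $q$ located at a vertex (write $\delta(v,q)$ for the distance from $v$ to it), released at time $r_q$ with a continuous, monotone non-decreasing delay function $d_q(t)$ tending to infinity, revealed at release. At any time the algorithm may perform the atomic action of choosing a vertex $v$, opening a facility at $v$ and connecting a subset $Q'$ of pending requests to it; this serves $Q'$, costs $f(v)+\sum_{q\in Q'}\delta(v,q)$, and the facility disappears immediately afterwards. The cost is the total cost of actions plus, for each request $q$, the delay $d_q(t_q)$ accumulated until its service time $t_q$. An online algorithm is $\alpha$-competitive if on every input its cost is at most $\alpha$ times the optimal offline cost. *)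

(* Defs.v *)
From HB Require Import structures.
From mathcomp Require Import all_boot all_order all_algebra.
From mathcomp Require Import all_classical all_reals all_analysis.

Set Implicit Arguments.
Unset Strict Implicit.
Unset Printing Implicit Defensive.

Import Order.TTheory GRing.Theory Num.Theory.
Import numFieldNormedType.Exports.

Local Open Scope classical_set_scope.
Local Open Scope ring_scope.

(* The connectedness field is what makes the shortest-path distance finite,
   hence a (pseudo)metric on the whole vertex set. *)
Record network (R : realType) := Network {
  vertex : finType;
  adj : rel vertex;
  adj_sym : symmetric adj;
  adj_irr : irreflexive adj;
  adj_connected : forall u v : vertex, connect adj u v;
  weight : vertex -> vertex -> R;
  weight_sym : forall u v : vertex, adj u v -> weight u v = weight v u;
  weight_ge0 : forall u v : vertex, adj u v -> 0 <= weight u v;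
  opening : vertex -> R;
  opening_ge0 : forall v : vertex, 0 <= opening v
}.

Section Problem.
Variables (R : realType) (G : network R).
Implicit Types (u v : vertex G).

Fixpoint walk_weight u (p : seq (vertex G)) : R :=
  if p is v :: p' then weight u v + walk_weight v p' else 0.

(* Walks may repeat vertices: weights are nonnegative on edges, so this does not
   change the infimum over simple paths. *)
Definition dist u v : R :=
  inf [set walk_weight u p | p in [set p | path (@adj R G) u p /\ last u p = v]].

Record request := Request {
  location : vertex G;
  release : R;
  delay : R -> R
}.

(* Only the values of the delay function from the release time on matter.
   The delay at release may be positive. *)
Definition valid_request (q : request) : Prop :=
  [/\ {within `[release q, +oo[, continuous (delay q)},
      {in `[release q, +oo[ &, {homo delay q : s t / s <= t}},
      0 <= delay q (release q)
    & delay q t @[t --> +oo] --> +oo].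

(* Requests are listed in order of arrival and named by their position in the
   list, so a request keeps its name whatever arrives later. *)
Definition valid_input (I : seq request) : Prop :=
  sorted (fun q q' => release q <= release q') I /\
  forall i : 'I_(size I), valid_request (tnth (in_tuple I) i).

Record action := Action {
  time : R;
  site : vertex G;
  served : seq nat
}.

Definition schedule := seq action.

(* Actions are listed in execution order. As every request occurs exactly once
   among the served ones, a released request is pending when it is served. *)
Definition feasible (I : seq request) (S : schedule) : Prop :=
  [/\ sorted (fun a b => time a <= time b) S,
      perm_eq (flatten [seq served a | a <- S]) (iota 0 (size I))
    & all (fun a => [forall i : 'I_(size I), ((i : nat) \in served a) ==>
                       (release (tnth (in_tuple I) i) <= time a)]) S].

Definition service_time (S : schedule) (i : nat) : R :=
  head 0 [seq time a | a <- S & i \in served a].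

Definition cost (I : seq request) (S : schedule) : R :=
  \sum_(a <- S)
     (opening (site a) +
      \sum_(i < size I | (i : nat) \in served a)
         dist (site a) (location (tnth (in_tuple I) i)))
  + \sum_(i < size I) delay (tnth (in_tuple I) i) (service_time S i).

Definition opt (I : seq request) : R := inf [set cost I S | S in feasible I].

Definition revealed (t : R) (I : seq request) : seq request :=
  [seq q <- I | release q <= t].

Definition executed (t : R) (S : schedule) : schedule :=
  [seq a <- S | time a <= t].

(* What is done up to time t depends only on what is released up to time t. *)
Definition nonanticipating (A : seq request -> schedule) : Prop :=
  forall (t : R) (I J : seq request), valid_input I -> valid_input J ->
    revealed t I = revealed t J -> executed t (A I) = executed t (A J).

Definition online_on (A : seq request -> schedule) : Prop :=
  (forall I, valid_input I -> feasible I (A I)) /\ nonanticipating A.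

Definition competitive_on (alpha : R) (A : seq request -> schedule) : Prop :=
  forall I, valid_input I -> cost I (A I) <= alpha * opt I.

End Problem.

(* The network is given in advance: it is an ordinary argument. *)
Definition algorithm (R : realType) : Type :=
  forall G : network R, seq (request G) -> schedule G.

Definition online_algorithm (R : realType) (A : algorithm R) : Prop :=
  forall G : network R, online_on (A G).

Definition competitive (R : realType) (alpha : nat -> R) (A : algorithm R) :
    Prop :=
  forall G : network R, competitive_on (alpha #|vertex G|) (A G).

(* Main.v *)
(* Pending requests carry a level. When the unpaid delay of the requests of level
   at most m reaches the budget B(m) = c 2^m, a service of level m takes place: it
   advances a clock until the cheapest way of either serving those requests or
   paying their delay up to the clock costs B(m), executes that solution, and
   raises the level of the unserved requests to m + 1. Its cost is O(B(m)).
   A service of level m + 1 is triggered by a request whose delay was paid up to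
   a time tau already passed; by minimality the optimum spent B(m), between the
   release of the requests involved and tau, on facilities, on connections or on
   delay, and for fixed m these time windows are disjoint. Delay and connection
   charges telescope because what was already paid for a request is deducted.
   A facility of cost f is charged at most min(f, B(m)) at level m, and nothing
   once n f <= B(m), hence O(f log n) in total. *)
Require Import Defs.
From HB Require Import structures.
From mathcomp Require Import all_boot all_order all_algebra.
From mathcomp Require Import all_classical all_reals all_analysis.
From mathcomp Require Import lra zify.

Set Implicit Arguments.
Unset Strict Implicit.
Unset Printing Implicit Defensive.

Import Order.TTheory GRing.Theory Num.Theory.
Import numFieldNormedType.Exports.

Local Open Scope classical_set_scope.
Local Open Scope ring_scope.

(** The doubling of the budgets is what makes the charging descend one level at a time. When level m
    + 1 triggers, the requests of level at most m account for at most B(m), half of the load, so a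
    request of level exactly m + 1 has unpaid delay. Hence its paid horizon tau lies in the past,
    and the certificate issued to it by a service of level m can be redeemed. The descent needs a
    bottom: c is at most every positive cost of opening a facility and connecting one request to it,
    and requests servable for free are served on arrival, so serving a level-0 request costs the
    optimum at least B(0). The problem asks for a map from whole inputs to schedules. The algorithm
    is therefore a transition system in which the plan for the future is a chosen function of the
    current state; it is non-anticipating because an arrival can only alter the plan from its
    release on. *)

Section Auxiliary.
Variable R : realType.
Implicit Types (f g : R -> R) (a b x : R).

(** The positive part of [x - a]: what remains of a charge [x] once the amount [a] already paid is
    deducted. *)
Definition exc a x : R := Num.max a x - a.

Lemma exc_ge0 a x : 0 <= exc a x.
Proof. by rewrite subr_ge0 le_max lexx. Qed.

Lemma exc_eq0 a x : x <= a -> exc a x = 0.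
Proof. by move=> xa; rewrite /exc max_l ?subrr. Qed.

Lemma exc_le a x y : x <= y -> exc a x <= exc a y.
Proof. by move=> xy; rewrite lerD2r ge_max !le_max lexx xy orbT. Qed.

Lemma le_exc a x : x <= a + exc a x.
Proof. by rewrite addrC subrK le_max lexx orbT. Qed.

Lemma exc_le_arg a x : 0 <= a -> 0 <= x -> exc a x <= x.
Proof. by move=> a0 x0; rewrite lerBlDr ge_max lerDr x0 lerDl a0. Qed.

Lemma max_exc a x : Num.max a x = a + exc a x.
Proof. by rewrite addrC subrK. Qed.

(** * Tools: intermediate values, continuity and finite minima *)

Lemma IVT_itvcy f a x : {within `[a, +oo[, continuous f} -> f a <= x ->
  (exists2 b, a <= b & x <= f b) -> exists2 c, a <= c & f c = x.
Proof.
move=> cf fax [b ab xfb].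
have cf' : {within `[a, b], continuous f}.
  by apply: continuous_subspaceW cf => y /=; rewrite !in_itv /= => /andP[->].
have [|c] := IVT ab cf' (v := x).
  by rewrite ge_min le_max fax xfb orbT.
by rewrite in_itv /= => /andP[ac _] <-; exists c.
Qed.

Lemma within_continuous_sum (A : set R) (T : eqType) (s : seq T) (P : pred T)
    (F : T -> R -> R) :
  (forall i, i \in s -> P i -> {within A, continuous (F i)}) ->
  {within A, continuous (fun t => \sum_(i <- s | P i) F i t)}.
Proof.
elim: s => [|i s IH] cF.
  under eq_fun do rewrite big_nil; exact: cst_continuous.
have cs : {within A, continuous (fun t => \sum_(j <- s | P j) F j t)}.
  by apply: IH => j js; apply: cF; rewrite inE js orbT.
case: (boolP (P i)) => Pi; last first.
  by under eq_fun do rewrite big_cons (negPf Pi).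
under eq_fun do rewrite big_cons Pi.
move=> t; apply: (@continuousD _ _ (subspace A) (F i)); last exact: cs.
by apply: cF; rewrite ?inE ?eqxx.
Qed.

Lemma within_continuous_exc (A : set R) f a :
  {within A, continuous f} -> {within A, continuous (fun t => exc a (f t))}.
Proof.
move=> cf t; apply: (@continuousB _ _ (subspace A) (fun t => Num.max a (f t))).
  by apply: (@continuous_max _ _ (fun=> a)); [exact: cst_continuous|exact: cf].
exact: cst_continuous.
Qed.

Lemma within_continuous_bigmin (A : set R) (T : eqType) (s : seq T)
    (P : pred T) (y : T -> R) f :
  {within A, continuous f} ->
  {within A, continuous (fun t => \big[Num.min/f t]_(v <- s | P v) y v)}.
Proof.
move=> cf; elim: s => [|i s IH].
  by under eq_fun do rewrite big_nil.
case: (boolP (P i)) => Pi; last first.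
  by under eq_fun do rewrite big_cons (negPf Pi).
under eq_fun do rewrite big_cons Pi.
move=> t; apply: (@continuous_min _ _ (fun=> y i)).
  exact: cst_continuous.
exact: IH.
Qed.

(** Ties go to a member of [F]. The strict inequality in the last clause later shows that no request
    stays unserved once delays have outgrown connection costs. *)
Lemma bigmin_witness (V : finType) (F : {set V}) (y : V -> R) x :
  exists o : option V,
    [/\ \big[Num.min/x]_(v in F) y v = (if o is Some v then y v else x),
        (forall v, o = Some v -> v \in F)
      & o = None -> forall v, v \in F -> x < y v].
Proof.
case: (boolP [exists v in F, y v <= x]) => [/exists_inP[v vF yvx]|].
  have := @arg_minP _ _ V v (mem F) y vF; case=> w wF wmin.
  exists (Some w); split=> //; last by move=> u [<-].
  apply/le_anti/andP; split; first exact: bigmin_le_cond.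
  apply/bigmin_geP; split=> [|u uF]; last exact: wmin.
  by apply: le_trans yvx; apply: wmin.
rewrite negb_exists_in => /forall_inP h.
have h' v : v \in F -> x < y v by move/h; rewrite -ltNge.
exists None; split => //.
apply/le_anti/andP; split; first exact: bigmin_le_id.
by apply/bigmin_geP; split=> // v /h'/ltW.
Qed.

Lemma sum_set_seq_le (V : finType) (s : seq V) (g : V -> R) :
  (forall v, 0 <= g v) ->
  \sum_(v in [set x in s]) g v <= \sum_(v <- s) g v.
Proof.
move=> g0; elim: s => [|v s IH].
  by rewrite big_nil big_pred0 // => v; rewrite inE.
rewrite big_cons.
case: (boolP (v \in s)) => vs.
  apply: le_trans (_ : _ <= \sum_(v in [set x in s]) g v) _.
    rewrite (eq_bigl (mem [set x in s])) // => u; rewrite !inE.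
    by case: eqVneq => // ->.
  by rewrite (le_trans IH)// lerDr.
rewrite (bigD1 v) ?inE ?eqxx//= lerD2l (le_trans _ IH)//.
rewrite (eq_bigl (mem [set x in s])) // => u; rewrite !inE.
by case: eqVneq => [->|]; rewrite ?(negPf vs) // andbT.
Qed.

End Auxiliary.

Lemma sum_assigned (Z : nmodType) (V : finType) (F : {set V}) (s : seq nat)
    (asg : nat -> option V) (X : nat -> V -> Z) :
  (forall i v, asg i = Some v -> v \in F) ->
  \sum_(v in F) \sum_(i <- s | asg i == Some v) X i v =
  \sum_(i <- s) (if asg i is Some v then X i v else 0).
Proof.
move=> hF; rewrite (exchange_big_dep predT)//=; apply: eq_bigr => i _.
case E: (asg i) => [v|]; last by rewrite big_pred0 // => v; rewrite andbF.
rewrite (big_pred1 v) // => u; rewrite /= -[Some v == _]/(v == u) eq_sym.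
by case: eqVneq => [->|]; rewrite ?andbF ?andbT // (hF _ _ E).
Qed.

(** * Budgets, discounted openings and the service rule *)

Section Algorithm.
Variables (R : realType) (G : network R).
Local Notation V := (vertex G).

Lemma walk_weight_ge0 (u : V) p : path (@adj R G) u p -> 0 <= walk_weight u p.
Proof.
elim: p u => //= v p IH u /andP[uv vp].
by rewrite addr_ge0 ?weight_ge0// IH.
Qed.

Lemma dist_ge0 (u v : V) : 0 <= dist u v.
Proof.
apply: lb_le_inf => [|_ [p [pp _] <-]]; last exact: walk_weight_ge0.
by have /connectP[p pp ->] := adj_connected u v; exists (walk_weight u p), p.
Qed.

Definition delay_of (P : seq (request G)) (i : nat) (t : R) : R :=
  if onth P i is Some q then delay q t else 0.

Definition dist_of (P : seq (request G)) (i : nat) (v : V) : R :=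
  if onth P i is Some q then dist v (location q) else 0.

Definition release_of (P : seq (request G)) (i : nat) : R :=
  if onth P i is Some q then release q else 0.

(** The constant c of the budgets. The bound 1 keeps it positive when no pair has a positive
    cost. *)
Definition unit_cost : R :=
  \big[Num.min/1]_(p : V * V | 0 < opening p.1 + dist p.1 p.2)
    (opening p.1 + dist p.1 p.2).

Lemma unit_cost_gt0 : 0 < unit_cost.
Proof. by apply/bigmin_gtP; split. Qed.

Lemma unit_cost_le (v u : V) : 0 < opening v + dist v u ->
  unit_cost <= opening v + dist v u.
Proof.
move=> h; exact: (bigmin_le_cond 1 (fun p : V * V => opening p.1 + dist p.1 p.2)
  (h : (fun p : V * V => 0 < opening p.1 + dist p.1 p.2) (v, u))).
Qed.

Definition budget (m : nat) : R := unit_cost * 2 ^+ m.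

Lemma budget_gt0 m : 0 < budget m.
Proof. by rewrite mulr_gt0 ?unit_cost_gt0 ?exprn_gt0. Qed.

Lemma budgetS m : budget m.+1 = 2 * budget m.
Proof. by rewrite /budget exprS mulrCA. Qed.

Lemma budget_le l m : (l <= m)%N -> budget l <= budget m.
Proof.
by move=> lm; rewrite ler_pM2l ?unit_cost_gt0// ler_eXn2l// ltr1n.
Qed.

Lemma budget_unbounded (x : R) : exists L, x < budget L.
Proof.
exists (Num.truncn (x / unit_cost)).+1.
rewrite -ltr_pdivrMl ?unit_cost_gt0// mulrC.
apply: lt_le_trans (truncnS_gt _) _; rewrite -natrX ler_nat ltnW //.
exact: ltn_expl.
Qed.

(* At level [m] a facility is free when all such facilities together cost at
   most [budget m]: this caps the number of levels that charge a facility. *)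
Definition level_opening (m : nat) (v : V) : R :=
  if #|V|%:R * opening v <= budget m then 0 else opening v.

Lemma level_opening_ge0 m v : 0 <= level_opening m v.
Proof. by rewrite /level_opening; case: ifP; rewrite // opening_ge0. Qed.

Lemma level_opening_le m v : level_opening m v <= opening v.
Proof. by rewrite /level_opening; case: ifP; rewrite // opening_ge0. Qed.

(** At most [#|V|] facilities are discounted, each of cost at most [budget m / #|V|], so really
    paying for them adds one budget. *)
Lemma sum_opening_le m (F : {set V}) :
  \sum_(v in F) opening v <= \sum_(v in F) level_opening m v + budget m.
Proof.
have [->|[w _]] := set_0Vmem F.
  by rewrite !big_set0 add0r ltW ?budget_gt0.
have n0 : 0 < #|V|%:R :> R by rewrite ltr0n; apply/card_gt0P; exists w.
have h v : opening v <= level_opening m v + budget m / #|V|%:R.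
  rewrite /level_opening; case: ifP => [fm|_].
    by rewrite add0r ler_pdivlMr// mulrC.
  by rewrite lerDl divr_ge0 ?ltW ?budget_gt0.
apply: le_trans (ler_sum _ (fun v _ => h v)) _.
rewrite big_split/= lerD2l sumr_const -[leLHS]mulr_natr mulrAC ler_pdivrMr//.
by rewrite ler_pM2l ?budget_gt0// ler_nat max_card.
Qed.

(* [lev] and [paid] are only meaningful on pending requests; [paid st i] is the
   delay of [i] already paid for, possibly ahead of time. *)
Record state := State {
  now : R;
  reqs : seq (request G);
  pend : seq nat;
  lev : nat -> nat;
  paid : nat -> R;
  log : schedule G;
  hist : seq nat
}.

Section Service.
Variables (d : nat -> R -> R) (cn : nat -> V -> R).
Implicit Types (st : state) (F : {set V}).

Definition load st (l : nat) (t : R) : R :=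
  \sum_(i <- pend st | (lev st i <= l)%N) exc (paid st i) (d i t).

(* A prize-collecting price: each eligible request either connects to [F] or has
   its delay paid up to time [t]. What was paid earlier for a request is deducted
   from its connection cost, so that a request considered at many levels is
   charged its connection cost only once overall. *)
Definition price st (m : nat) F (t : R) : R :=
  \sum_(v in F) level_opening m v +
  \sum_(i <- pend st | (lev st i <= m)%N)
    \big[Num.min/exc (paid st i) (d i t)]_(v in F) exc (paid st i) (cn i v).

(** [asg] gives [None] to the requests left waiting. The actions take place at [t], yet [paid]
    already advances to the delay at [tau]. *)
Definition after_service st (t : R) (m : nat) F (asg : nat -> option V)
    (tau : R) : state :=
  let eligible i := (i \in pend st) && (lev st i <= m)%N in
  State t (reqs st) [seq i <- pend st | asg i == None]
    (fun i => if eligible i then m.+1 else lev st i)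
    (fun i => if eligible i then Num.max (paid st i) (d i tau) else paid st i)
    (log st ++
      [seq Action t v [seq i <- pend st | asg i == Some v] | v <- enum F])
    (m :: hist st).

(* The service takes place at [t]; [tau] is the time up to which the delay of the
   eligible requests left unserved is paid in advance. *)
Variant service st : state -> Prop :=
  Service t m F asg tau of
    now st <= t & t <= tau
  & (forall l, load st l t <= budget l)
  & load st m t = budget m
  & (forall i v, asg i = Some v ->
       [/\ i \in pend st, (lev st i <= m)%N & v \in F])
  & \sum_(v in F) level_opening m v +
    \sum_(i <- pend st | (lev st i <= m)%N)
      (if asg i is Some v then exc (paid st i) (cn i v)
       else exc (paid st i) (d i tau)) <= budget m
  & {in pend st, forall i, (lev st i <= m)%N -> asg i != None} \/
    (forall F', budget m <= price st m F' tau) :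
  service st (after_service st t m F asg tau).

Lemma load_mono st l (s t : R) :
  {in pend st, forall i, d i s <= d i t} -> load st l s <= load st l t.
Proof.
move=> h; rewrite /load big_seq_cond [leRHS]big_seq_cond.
apply: ler_sum => i /andP[ip _].
exact/exc_le/h.
Qed.

Lemma exc_le_load st l t i : i \in pend st -> (lev st i <= l)%N ->
  exc (paid st i) (d i t) <= load st l t.
Proof.
move=> ip il; rewrite /load (big_rem i)//= il lerDl.
by apply: sumr_ge0 => j _; apply: exc_ge0.
Qed.

(** * Existence of a service *)

Section Existence.
Variable st : state.
Local Notation t0 := (now st).
Hypothesis dcont :
  {in pend st, forall i, {within `[t0, +oo[, continuous (d i)}}.
Hypothesis dmono :
  {in pend st, forall i, forall s t, t0 <= s -> s <= t -> d i s <= d i t}.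
Hypothesis dinf :
  {in pend st, forall i, forall A, exists2 t, t0 <= t & A <= d i t}.
Hypothesis noncritical : forall l, load st l t0 <= budget l.
Hypothesis pend_neq0 : pend st != [::].

Lemma load_cont l : {within `[t0, +oo[, continuous (load st l)}.
Proof.
apply: within_continuous_sum => i ip _; apply: within_continuous_exc.
exact: dcont.
Qed.

Lemma price_cont m F : {within `[t0, +oo[, continuous (price st m F)}.
Proof.
move=> t; apply: (@continuousD _ _ (subspace _) (fun=> _)).
  exact: cst_continuous.
move: t; apply: within_continuous_sum => i ip _.
by apply: within_continuous_bigmin; apply: within_continuous_exc; apply: dcont.
Qed.

Lemma price_mono m F (s t : R) :
  t0 <= s -> s <= t -> price st m F s <= price st m F t.
Proof.
move=> ts st'; rewrite lerD2l big_seq_cond [leRHS]big_seq_cond.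
apply: ler_sum => i /andP[ip _].
apply/bigmin_geP; split; first last.
  by move=> v vF; apply: bigmin_le_cond.
apply: le_trans (bigmin_le_id _ _ _ _) _.
by apply: exc_le; apply: dmono.
Qed.

Lemma delay_simultaneously_large (K : nat -> R) (b : R) : t0 <= b ->
  exists2 t, b <= t & {in pend st, forall i, K i <= d i t}.
Proof.
move=> tb.
suff [t bt ht] : exists2 t, b <= t &
    forall i, i \in pend st -> i \in pend st -> K i <= d i t.
  by exists t => // i ip; apply: ht.
elim: {1}(pend st) => [|i s [t bt IH]]; first by exists b.
case: (boolP (i \in pend st)) => [ip|ip]; last first.
  exists t => // j; rewrite inE => /orP[/eqP -> jp|]; last exact: IH.
  by rewrite jp in ip.
have [u tu Ku] := dinf ip (K i).
exists (Num.max t u); first by rewrite le_max bt.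
move=> j; rewrite inE => /orP[/eqP -> _|js jp].
  by apply: le_trans Ku _; apply: dmono; rewrite // le_max lexx orbT.
apply: le_trans (IH _ js jp) _; apply: dmono => //.
  exact: le_trans bt.
by rewrite le_max lexx.
Qed.

(** Levels above the largest pending one share its load and have larger budgets, so finitely many
    matter. A time saturating the top level is moved back once for each violated level; monotone
    loads preserve the bounds already secured. *)
Lemma critical_time : exists2 t, t0 <= t &
  (forall l, load st l t <= budget l) /\ exists m, load st m t = budget m.
Proof.
pose L := \max_(i <- pend st) lev st i.
have levL i : i \in pend st -> (lev st i <= L)%N.
  by move=> ip; rewrite /L (big_rem i)//= leq_maxl.
have loadL l t : (L <= l)%N -> load st l t = load st L t.
  move=> Ll; rewrite /load big_seq_cond [RHS]big_seq_cond.
  apply: eq_bigl => i; case: (boolP (i \in _)) => //= /levL iL.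
  by rewrite iL (leq_trans iL).
have [tL t0L loadtL] : exists2 t, t0 <= t & load st L t = budget L.
  apply: IVT_itvcy => //; first exact: load_cont.
  have [b t0b hb] :=
    delay_simultaneously_large (fun i => paid st i + budget L) (lexx t0).
  exists b => //.
  have [i ip] : exists i, i \in pend st.
    by case: (pend st) pend_neq0 => // i s _; exists i; rewrite inE eqxx.
  apply: le_trans (exc_le_load _ ip (levL _ ip)).
  by rewrite lerBrDl (le_trans (hb _ ip))// le_max lexx orbT.
suff [t t0t [ht hm]] : exists2 t, t0 <= t &
    (forall l, (l < L)%N || (L <= l)%N -> load st l t <= budget l) /\
    exists m, load st m t = budget m.
  by exists t => //; split => // l; apply: ht; rewrite ltnNge orNb.
elim: {1}L => [|k [t t0t [ht hm]]].
  exists tL => //; split=> [l /= Ll|]; last by exists L.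
  by rewrite loadL// loadtL budget_le.
have [hk|hk] := leP (load st k t) (budget k).
  exists t => //; split=> // l; rewrite ltnS leq_eqVlt -orbA.
  by move=> /orP[/eqP ->//|]; apply: ht.
have [u t0u hu] : exists2 u, t0 <= u & load st k u = budget k.
  by apply: IVT_itvcy; [exact: load_cont|exact: noncritical|exists t => //; exact: ltW].
exists u => //; split; last by exists k.
move=> l; rewrite ltnS leq_eqVlt -orbA => /orP[/eqP ->|hl]; first by rewrite hu.
have [ut|/ltW tu] := leP u t.
  by apply: le_trans (ht _ hl); apply: load_mono => i ip; apply: dmono.
have : load st k t <= load st k u by apply: load_mono => i ip; apply: dmono.
by rewrite hu leNgt hk.
Qed.

(** The clock [tau] advances until no set [F] is priced below the budget. This fails only if some
    [F] stays below it at [M], a time when waiting is at least as dear as any connection; that [F]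
    then serves every eligible request. *)
Lemma service_exists : exists st', service st st'.
Proof.
have [t t0t [ht [m hm]]] := critical_time.
have [M tM hM] := delay_simultaneously_large
  (fun i => paid st i + \sum_v exc (paid st i) (cn i v)) t0t.
have /choice[wit witP] : forall x : {set V} * R * nat, exists o : option V,
    [/\ \big[Num.min/exc (paid st x.2) (d x.2 x.1.2)]_(v in x.1.1)
           exc (paid st x.2) (cn x.2 v) =
         (if o is Some v then exc (paid st x.2) (cn x.2 v)
          else exc (paid st x.2) (d x.2 x.1.2)),
        (forall v, o = Some v -> v \in x.1.1)
      & o = None -> forall v, v \in x.1.1 ->
          exc (paid st x.2) (d x.2 x.1.2) < exc (paid st x.2) (cn x.2 v)].
  by move=> x; apply: bigmin_witness.
pose asg F tau i :=
  if (i \in pend st) && (lev st i <= m)%N then wit (F, tau, i) else None.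
have build F tau : t <= tau -> price st m F tau <= budget m ->
    {in pend st, forall i, (lev st i <= m)%N -> asg F tau i != None} \/
    (forall F', budget m <= price st m F' tau) ->
    exists st', service st st'.
  move=> ttau hp hpi; exists (after_service st t m F (asg F tau) tau).
  apply: Service => // [i v|].
    rewrite /asg; case: ifP => // /andP[ip im] E; split=> //.
    by have [_ + _] := witP (F, tau, i); apply.
  apply: le_trans hp; rewrite lerD2l big_seq_cond [leRHS]big_seq_cond.
  apply: ler_sum => i /andP[ip im].
  have [-> _ _] := witP (F, tau, i).
  by rewrite /asg ip im.
have price0 s : price st m finset.set0 s = load st m s.
  by rewrite /price big_set0 add0r; apply: eq_bigr => i _; rewrite big_set0.
have [[F hF]|nF] := pselect (exists F, price st m F M < budget m).
  apply: (build F M) => //; first exact: ltW.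
  left=> i ip im; rewrite /asg ip im /=.
  apply/eqP; have [_ _ + E] := witP (F, M, i) => /(_ E) /=.
  (* The empty set is excluded: its price is the load, which is already [budget m] at [t]. *)
  have [F0|[v vF]] := set_0Vmem F.
    suff : budget m < budget m by rewrite ltxx.
    rewrite -{1}hm -price0 -F0; apply: le_lt_trans hF.
    exact: price_mono.
  move=> /(_ v vF); apply/negP; rewrite -leNgt.
  apply: le_trans (_ : _ <= \sum_v exc (paid st i) (cn i v)) _.
    by rewrite (bigD1 v)//= lerDl; apply: sumr_ge0 => u _; apply: exc_ge0.
  by rewrite lerBrDl (le_trans (hM _ ip))// le_max lexx orbT.
have hMF F : budget m <= price st m F M.
  by rewrite leNgt; apply/negP => h; apply: nF; exists F.
suff [tau ttau [[F hF] htau]] : exists2 tau, t <= tau &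
    (exists F, price st m F tau <= budget m) /\
    (forall F, F \in enum {: {set V}} -> budget m <= price st m F tau).
  by apply: (build F tau) => //; right=> F'; apply: htau; rewrite mem_enum.
(* Invariant: at [tau] the sets treated so far have reached the budget, and some set does not exceed
   it. If [F] is still cheaper, [tau] grows until [F] meets the budget and becomes that set. *)
elim: (enum _) => [|F s [tau ttau [hF hs]]].
  by exists t => //; split=> //; exists finset.set0; rewrite price0 hm.
have t0tau := le_trans t0t ttau.
have [h|/ltW h] := leP (budget m) (price st m F tau).
  exists tau => //; split=> // F'; rewrite inE => /orP[/eqP ->//|]; exact: hs.
have [u tauu hu] : exists2 u, tau <= u & price st m F u = budget m.
  apply: IVT_itvcy => //.
    apply: continuous_subspaceW (@price_cont m F) => y /=.
    by rewrite !in_itv /= !andbT; apply: le_trans.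
  have [tauM|/ltW Mtau] := leP tau M; first by exists M.
  exists tau => //; apply: le_trans (hMF F) _.
  by apply: price_mono => //; apply: le_trans tM.
exists u; first exact: le_trans tauu.
split; first by exists F; rewrite hu.
move=> F'; rewrite inE => /orP[/eqP ->|/hs hF']; first by rewrite hu.
by apply: le_trans hF' _; apply: price_mono.
Qed.

End Existence.
End Service.
End Algorithm.

(** * Reachable states and their well-formedness *)

Section Run.
Variables (R : realType) (G : network R).
Local Notation V := (vertex G).
Implicit Types (st : state G) (q : request G) (P I J : seq (request G)).

Definition valid_requests P : Prop :=
  forall i q, onth P i = Some q -> valid_request q.

Lemma onth_tnth I (i : 'I_(size I)) : onth I i = Some (tnth (in_tuple I) i).
Proof.
rewrite onthE (tnth_nth (tnth (in_tuple I) i)) /=.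
by rewrite (nth_map (tnth (in_tuple I) i)).
Qed.

Lemma valid_input_requests I : valid_input I -> valid_requests I.
Proof.
move=> [_ vI] i q E.
have iI : (i < size I)%N by rewrite -onthTE E.
by move: E; rewrite -[i]/(nat_of_ord (Ordinal iI)) onth_tnth => -[<-].
Qed.

Lemma valid_requests_cat P J :
  valid_requests (P ++ J) -> valid_requests P /\ valid_requests J.
Proof.
move=> v; split=> i q E; last first.
  by apply: (v (size P + i)%N); rewrite onth_cat ltnNge leq_addr /= addKn.
by apply: (v i); rewrite onth_cat -onthTE E.
Qed.

Lemma dist_of_ge0 P i v : 0 <= dist_of P i v.
Proof. by rewrite /dist_of; case: onth => // q; apply: dist_ge0. Qed.

Lemma delay_of_cat P J i : (i < size P)%N -> delay_of (P ++ J) i = delay_of P i.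
Proof. by move=> iP; apply/funext => t; rewrite /delay_of onth_cat iP. Qed.

Lemma dist_of_cat P J i : (i < size P)%N -> dist_of (P ++ J) i = dist_of P i.
Proof. by move=> iP; apply/funext => t; rewrite /dist_of onth_cat iP. Qed.

Lemma release_of_cat P J i :
  (i < size P)%N -> release_of (P ++ J) i = release_of P i.
Proof. by move=> iP; rewrite /release_of onth_cat iP. Qed.

Section Validity.
Variable P : seq (request G).
Hypothesis vP : valid_requests P.

Lemma delay_of_mono i (s t : R) : release_of P i <= s -> s <= t ->
  delay_of P i s <= delay_of P i t.
Proof.
rewrite /release_of /delay_of; case E: (onth P i) => [q|//] rs st.
have [_ mono _ _] := vP E; apply: mono => //; rewrite in_itv /= andbT//.
exact: le_trans st.
Qed.

Lemma delay_of_ge0 i (t : R) : release_of P i <= t -> 0 <= delay_of P i t.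
Proof.
move=> rt; apply: le_trans (delay_of_mono (lexx _) rt).
rewrite /release_of /delay_of; case E: (onth P i) => [q|//].
by have [_ _ + _] := vP E.
Qed.

Lemma delay_of_cont i (a : R) : release_of P i <= a ->
  {within `[a, +oo[, continuous (delay_of P i)}.
Proof.
rewrite /release_of /delay_of; case E: (onth P i) => [q|] ra; last first.
  exact: cst_continuous.
have [cont _ _ _] := vP E; apply: continuous_subspaceW cont => y /=.
by rewrite !in_itv /= !andbT; apply: le_trans.
Qed.

Lemma delay_of_unbounded i (a A : R) : (i < size P)%N ->
  exists2 t, a <= t & A <= delay_of P i t.
Proof.
rewrite -onthTE /delay_of; case E: (onth P i) => [q|//] _.
have [_ _ _ /cvgryPge/(_ A) [M [_ hM]]] := vP E.
exists (Num.max a (M + 1)); first by rewrite le_max lexx.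
by apply: hM; rewrite lt_max ltrDl ltr01 orbT.
Qed.

End Validity.

(** Lets a step computed from the requests known so far be analysed with the data of the complete
    input. *)
Lemma service_ext (d d' : nat -> R -> R) (cn cn' : nat -> V -> R) st st' :
  {in pend st, d =1 d'} -> {in pend st, cn =1 cn'} ->
  service d cn st st' -> service d' cn' st st'.
Proof.
move=> dd cc [t m F asg tau nt ttau ldle ldeq has hp hor].
have -> : after_service d st t m F asg tau = after_service d' st t m F asg tau.
  congr State; apply/funext => i.
  by case: (boolP (i \in pend st)) => //= ip; rewrite dd.
have ldE l u : load d' st l u = load d st l u.
  rewrite /load big_seq_cond [RHS]big_seq_cond.
  by apply: eq_bigr => i /andP[ip _]; rewrite dd.
apply: Service => //; [by move=> l; rewrite ldE|by rewrite ldE| |].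
  apply: le_trans hp; rewrite lerD2l big_seq_cond [leRHS]big_seq_cond.
  by apply: ler_sum => i /andP[ip _]; case: (asg i) => [v|]; rewrite ?dd ?cc.
case: hor => [|h]; [by left|right=> F'].
apply: le_trans (h F') _; rewrite lerD2l big_seq_cond [leRHS]big_seq_cond.
apply: ler_sum => i /andP[ip _]; rewrite dd //.
by under [leRHS]eq_bigr do rewrite -cc //.
Qed.

Definition init_state (t : R) : state G :=
  State t [::] [::] (fun=> 0%N) (fun=> 0) [::] [::].

(** Serving free requests on the spot leaves pending only requests that cost at least [unit_cost].
    The delay at release counts as paid, since every schedule incurs it. *)
Definition arrive st q : state G :=
  let i := size (reqs st) in
  if [pick v | opening v + dist v (location q) == 0] is Some v then
    State (release q) (rcons (reqs st) q) (pend st) (lev st) (paid st)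
      (rcons (log st) (Action (release q) v [:: i])) (hist st)
  else
    State (release q) (rcons (reqs st) q) (i :: pend st)
      (fun j => if j == i then 0%N else lev st j)
      (fun j => if j == i then delay q (release q) else paid st j)
      (log st) (hist st).

Definition step st st' : Prop :=
  service (delay_of (reqs st)) (dist_of (reqs st)) st st'.

(** The load condition on arrivals says that no trigger was missed; it preserves [wf_load] when the
    clock jumps to the release. *)
Inductive reachable (t0 : R) : state G -> Prop :=
| reach_init : reachable t0 (init_state t0)
| reach_step st st' : reachable t0 st -> step st st' -> reachable t0 st'
| reach_arrive st q : reachable t0 st -> now st <= release q ->
    valid_request q ->
    (forall l, load (delay_of (reqs st)) st l (release q) <= budget G l) ->
    reachable t0 (arrive st q).

Record wf st : Prop := Wf {
  wf_valid : valid_requests (reqs st);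
  wf_release : forall i, (i < size (reqs st))%N ->
    release_of (reqs st) i <= now st;
  wf_served : perm_eq (flatten [seq served a | a <- log st] ++ pend st)
    (iota 0 (size (reqs st)));
  wf_paid : {in pend st, forall i, 0 <= paid st i};
  wf_load : forall l,
    load (delay_of (reqs st)) st l (now st) <= budget G l;
  wf_unit_cost : {in pend st, forall i v,
    unit_cost G <= opening v + dist_of (reqs st) i v};
  wf_sorted : sorted (fun a b => time a <= time b) (log st);
  wf_log : all (fun a => (time a <= now st) &&
    all (fun i => release_of (reqs st) i <= time a) (served a)) (log st)
}.

Lemma wf_uniq st : wf st -> uniq (pend st).
Proof.
move=> w; have := wf_served w => /perm_uniq; rewrite iota_uniq cat_uniq.
by case/and3P.
Qed.

Lemma wf_size st i : wf st -> i \in pend st -> (i < size (reqs st))%N.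
Proof.
move=> w ip; have := perm_mem (wf_served w) i.
by rewrite mem_cat ip orbT mem_iota add0n => /esym /andP[].
Qed.

Lemma wf_pend_release st i : wf st -> i \in pend st ->
  release_of (reqs st) i <= now st.
Proof. by move=> w ip; apply: wf_release => //; apply: wf_size. Qed.

Lemma wf_init t : wf (init_state t).
Proof. by split=> // [i q|l]; rewrite ?onth0n// /load big_nil ltW ?budget_gt0. Qed.

Lemma sorted_log_cat st (t : R) (s : schedule G) : wf st -> now st <= t ->
  all (fun a => time a == t) s ->
  sorted (fun a b => time a <= time b) (log st ++ s).
Proof.
move=> w nt; have := wf_sorted w.
have : all (fun a => time a <= t) (log st).
  by apply: sub_all (wf_log w) => a /andP[h _]; apply: le_trans nt.
elim: (log st) => [_ _|a l IH] /=.
  elim: s => //= a s IH /andP[/eqP at_ hs].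
  case: s IH hs => //= b s IH /andP[/eqP bt hs]; rewrite at_ bt lexx /=.
  by apply: IH; rewrite /= bt eqxx.
move=> /andP[at_ lt_] + ht; case: l IH lt_ => [|b l] IH lt_ /=; last first.
  by move=> /andP[-> h]; apply: IH.
move=> _; have := IH isT isT ht.
by case: s ht {IH} => //= b s /andP[/eqP -> _] ->; rewrite at_.
Qed.

Lemma wf_step st st' : wf st -> step st st' -> wf st'.
Proof.
move=> w [t m F asg tau nt ttau ldle ldeq has hp _].
split=> /=; first exact: wf_valid.
- by move=> i iP; apply: le_trans nt; apply: wf_release.
- rewrite map_cat flatten_cat -catA.
  apply: perm_trans (wf_served w); rewrite perm_cat2l.
  rewrite -map_comp perm_sym.
  rewrite -(perm_filterC (fun i => asg i != None) (pend st)).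
  have -> : [seq i <- pend st | predC (fun i => asg i != None) i] =
            [seq i <- pend st | asg i == None].
    by apply: eq_filter => i /=; rewrite negbK.
  rewrite perm_cat2r; apply/permP => a.
  rewrite count_flatten -!map_comp sumnE big_map big_enum /=.
  under [RHS]eq_bigr => v _ do
    rewrite -sum1_count big_filter_cond big_mkcondr /=.
  rewrite (@sum_assigned _ _ _ _ _ (fun i _ => if a i then 1%N else 0%N)).
    rewrite -sum1_count big_filter_cond big_mkcond /=.
    by apply: eq_bigr => i _; case: (asg i).
  by move=> i v /has[].
- move=> i; rewrite mem_filter => /andP[_ ip]; rewrite ip /=.
  by case: ifP => _; rewrite ?le_max wf_paid.
(* Loads only drop: a request is served, or ineligible and unchanged, or raised with [paid] covering
   its delay at [t], because [t <= tau]. *)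
- move=> l; apply: le_trans (ldle l); rewrite /load /= big_filter_cond.
  rewrite [leLHS]big_mkcond [leRHS]big_mkcond big_seq [leRHS]big_seq /=.
  apply: ler_sum => i ip; rewrite ip /=.
  case: (asg i == None) => /=; last by case: ifP => // _; apply: exc_ge0.
  case: (leqP (lev st i) m) => // im; case: ifP => _.
    rewrite exc_eq0; first by case: ifP => // _; apply: exc_ge0.
    rewrite le_max (delay_of_mono (wf_valid w)) ?orbT//.
    exact: le_trans (wf_pend_release w ip) nt.
  by case: ifP => // _; apply: exc_ge0.
- by move=> i; rewrite mem_filter => /andP[_ ip]; apply: wf_unit_cost.
- by apply: sorted_log_cat nt _ => //; rewrite all_map; apply/allP => v _ /=.
- rewrite all_cat; apply/andP; split.
    apply: sub_all (wf_log w) => a /andP[at_ ->]; rewrite andbT.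
    exact: le_trans nt.
  rewrite all_map; apply/allP => v _ /=; rewrite lexx /=.
  apply/allP => i; rewrite mem_filter => /andP[_ ip].
  exact: le_trans (wf_pend_release w ip) nt.
Qed.

Lemma wf_arrive st q : wf st -> now st <= release q -> valid_request q ->
  (forall l, load (delay_of (reqs st)) st l (release q) <= budget G l) ->
  wf (arrive st q).
Proof.
move=> w nq vq hl.
have onq i : onth (rcons (reqs st) q) i =
    if (i < size (reqs st))%N then onth (reqs st) i
    else if i == size (reqs st) then Some q else None.
  rewrite -cats1 onth_cat; case: ltnP => // h.
  rewrite eqn_leq h andbT -subn_eq0; case: (i - _)%N => // k.
  by rewrite onth_default.
have rq i : (i < size (reqs st))%N ->
    release_of (rcons (reqs st) q) i = release_of (reqs st) i.
  by rewrite -cats1; apply: release_of_cat.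
have rqn : release_of (rcons (reqs st) q) (size (reqs st)) = release q.
  by rewrite /release_of onq ltnn eqxx.
have validq : valid_requests (rcons (reqs st) q).
  move=> i p; rewrite onq; case: ifP => _; first exact: wf_valid.
  by case: ifP => // _ [<-].
have releaseq i : (i < size (rcons (reqs st) q))%N ->
    release_of (rcons (reqs st) q) i <= release q.
  rewrite size_rcons ltnS leq_eqVlt => /orP[/eqP ->|iP]; first by rewrite rqn.
  by rewrite rq// (le_trans _ nq)// wf_release.
have servedP : perm_eq (size (reqs st) ::
    (flatten [seq served a | a <- log st] ++ pend st))
    (iota 0 (size (rcons (reqs st) q))).
  rewrite size_rcons -addn1 iotaD add0n perm_sym perm_catC /= perm_cons perm_sym.
  exact: wf_served.
have servedlt a i : a \in [seq served a | a <- log st] -> i \in a ->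
    (i < size (reqs st))%N.
  move=> la ia; have := perm_mem (wf_served w) i.
  have -> : i \in flatten [seq served a | a <- log st] ++ pend st.
    by rewrite mem_cat; apply/orP; left; apply/flattenP; exists a.
  by rewrite mem_iota add0n => /esym.
have logq : all (fun a => (time a <= release q) &&
    all (fun i => release_of (rcons (reqs st) q) i <= time a) (served a))
    (log st).
  elim: (log st) (wf_log w) servedlt => //= a l IH /andP[/andP[an ar] hl'] hs.
  rewrite (le_trans an nq) /= IH //; last first.
    by move=> b i bl; apply: hs; rewrite inE bl orbT.
  rewrite andbT; apply/allP => i ia; rewrite rq; first exact: (allP ar).
  by apply: hs ia; rewrite inE eqxx.
rewrite /arrive; case: pickP => [v /eqP v0|npick]; split=> //=.
- rewrite map_rcons flatten_rcons -catA; apply: perm_trans servedP.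
  by rewrite perm_catCA.
- exact: wf_paid.
- move=> l; apply: le_trans (hl l); rewrite /load /=.
  rewrite big_seq_cond [leRHS]big_seq_cond.
  apply: ler_sum => i /andP[ip _].
  by rewrite -cats1 delay_of_cat // wf_size.
- move=> i ip u; rewrite -cats1 dist_of_cat ?wf_size//.
  exact: wf_unit_cost.
- by rewrite -cats1; apply: sorted_log_cat nq _ => //=; rewrite eqxx.
- by rewrite all_rcons /= lexx rqn lexx.
- by apply: perm_trans servedP; rewrite perm_sym -cat1s perm_catCA.
- move=> i; rewrite inE; case: eqVneq => [_ _|_ /= ip]; last exact: wf_paid.
  by case: vq.
- move=> l; rewrite /load /= big_cons eqxx leq0n.
  rewrite exc_eq0 ?add0r; last by rewrite /delay_of onq ltnn eqxx.
  apply: le_trans (hl l); rewrite /load.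
  rewrite big_seq_cond [leRHS]big_seq_cond.
  have h i : i \in pend st -> (i == size (reqs st)) = false.
    by move=> /(wf_size w); case: ltngtP.
  rewrite le_eqVlt; apply/orP; left; apply/eqP.
  apply: eq_big => [i|i /andP[ip _]].
    by case: (boolP (i \in _)) => // /h ->.
  by rewrite h// -cats1 delay_of_cat // wf_size.
- move=> i; rewrite inE; case: eqVneq => [-> _|_ /= ip] v; last first.
    rewrite -cats1 dist_of_cat ?wf_size//; exact: wf_unit_cost.
  rewrite /dist_of onq ltnn eqxx; apply: unit_cost_le.
  by rewrite lt_def npick addr_ge0 ?opening_ge0 ?dist_ge0.
- exact: wf_sorted.
Qed.

Lemma reachable_wf t0 st : reachable t0 st -> wf st.
Proof.
elim=> [|s s' _ ws|s q _ ws]; [exact: wf_init|exact: wf_step|exact: wf_arrive].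
Qed.

End Run.

(** * The online algorithm: termination and non-anticipation *)

Section Online.
Variables (R : realType) (G : network R).
Local Notation V := (vertex G).
Implicit Types (st : state G) (q : request G) (P I J : seq (request G)).

Fixpoint chain st (p : seq (state G)) {struct p} : Prop :=
  if p is s :: p' then step st s /\ chain s p' else True.

Lemma step_exists st : wf st -> pend st != [::] -> exists st', step st st'.
Proof.
move=> w ne; apply: service_exists => //.
- by move=> i ip; apply: (delay_of_cont (wf_valid w)); apply: wf_pend_release.
- move=> i ip s t ns st'; apply: (delay_of_mono (wf_valid w)) => //.
  exact: le_trans (wf_pend_release w ip) ns.
- by move=> i ip A; apply: delay_of_unbounded; [exact: wf_valid|exact: wf_size].
- exact: wf_load.
Qed.

(* Once the budget exceeds the cost of serving all pending requests, a service
   leaves no eligible request behind, so levels stay bounded. *)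
Lemma step_measure st st' L : wf st -> step st st' ->
  {in pend st, forall i, (lev st i <= L)%N} ->
  \sum_(v : V) opening v + \sum_(i <- pend st) \sum_v dist_of (reqs st) i v
    < budget G L ->
  [/\ {in pend st', forall i, (lev st' i <= L)%N},
      \sum_(v : V) opening v + \sum_(i <- pend st') \sum_v dist_of (reqs st') i v
        < budget G L
    & (\sum_(i <- pend st') (L.+1 - lev st' i) <
       \sum_(i <- pend st) (L.+1 - lev st i))%N].
Proof.
move=> w [t m F asg tau nt ttau ldle ldeq has hp hor] levL big.
have served_above i : i \in pend st -> (lev st i <= m)%N -> asg i == None ->
    (m < L)%N.
  move=> ip im ai; rewrite ltnNge; apply/negP => Lm.
  case: hor => [/(_ i ip im)|/(_ finset.setT)]; first by rewrite ai.
  apply/negP; rewrite -ltNge.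
  apply: lt_le_trans (budget_le G Lm); apply: le_lt_trans big.
  apply: lerD.
    rewrite (eq_bigl predT) => [|v]; last by rewrite finset.in_setT.
    by apply: ler_sum => v _; apply: level_opening_le.
  rewrite big_mkcond big_seq [leRHS]big_seq; apply: ler_sum => j jp.
  case: ifP => _; last by apply: sumr_ge0 => v _; apply: dist_of_ge0.
  have := wf_size w jp; rewrite -onthTE; case E: (onth _ _) => [q|//] _.
  apply: le_trans (bigmin_le_cond _ _ (finset.in_setT (location q))) _.
  apply: le_trans (exc_le_arg _ _) _; rewrite ?wf_paid ?dist_of_ge0//.
  rewrite (bigD1 (location q))//= lerDl.
  by apply: sumr_ge0 => v _; apply: dist_of_ge0.
split=> /=.
- move=> i; rewrite mem_filter => /andP[ai ip]; rewrite ip /=.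
  case: ifP => im; last exact: levL.
  exact: (served_above i).
- apply: le_lt_trans big; rewrite lerD2l big_filter big_mkcond /=.
  apply: ler_sum => i _; case: ifP => // _.
  by apply: sumr_ge0 => v _; apply: dist_of_ge0.
(* A positive load has a contributor, which leaves or gains a level; this makes the decrease
   strict. *)
- have [i ip im] : exists2 i, i \in pend st & (lev st i <= m)%N.
    apply/not_exists2P => h; suff : budget G m <= 0.
      by apply/negP; rewrite -ltNge budget_gt0.
    rewrite -ldeq /load big_seq_cond big1 // => i /andP[ip im].
    by case: (h i).
  have up := wf_uniq w.
  rewrite big_filter big_mkcond /= (bigD1_seq i)//= [ltnRHS](bigD1_seq i)//=.
  rewrite -addSn leq_add//.
    rewrite ip im /=; case: ifP => ai; last by rewrite subn_gt0 ltnS levL.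
    have mL := served_above _ ip im ai.
    by rewrite subSS; move: im mL (levL _ ip); lia.
  apply: leq_sum => j _; case: ifP => // aj.
  by case: ifP => // /andP[_ jm]; apply: leq_sub2l; rewrite ltnW // ltnS.
Qed.

Lemma completion st : wf st ->
  exists p, chain st p /\ pend (last st p) = [::].
Proof.
move=> w.
have [K hK] := budget_unbounded G (\sum_(v : V) opening v +
  \sum_(i <- pend st) \sum_v dist_of (reqs st) i v).
pose M := \max_(i <- pend st) lev st i.
have levM : {in pend st, forall i, (lev st i <= maxn K M)%N}.
  by move=> i ip; rewrite leq_max /M (big_rem i)//= leq_maxl orbT.
have {hK} := lt_le_trans hK (budget_le G (leq_maxl K M)).
move: (maxn K M) levM => L {K M}.
have [n] := ubnP (\sum_(i <- pend st) (L.+1 - lev st i))%N.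
elim: n st w => // n IH st w; rewrite ltnS => hn levL big.
case: (eqVneq (pend st) [::]) => [p0|pn0]; first by exists [::].
have [st' nst] := step_exists w pn0.
have [levL' big' lt'] := step_measure w nst levL big.
have [p [cp p0]] := IH _ (wf_step w nst) (leq_trans lt' hn) levL' big'.
by exists (st' :: p).
Qed.

(** The plan followed if nothing more arrives. Choice fixes one plan per state, so the algorithm is
    deterministic. *)
Definition complete st : seq (state G) :=
  if pselect (exists p, chain st p /\ pend (last st p) = [::]) is left e
  then projT1 (cid e) else [::].

Lemma completeP st : wf st ->
  chain st (complete st) /\ pend (last st (complete st)) = [::].
Proof.
move=> w; rewrite /complete; case: pselect => [e|]; first exact: (projT2 (cid e)).
by move=> /(_ (completion w)).
Qed.

Definition finish st : state G := last st (complete st).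

(* Executes the planned services up to [r]; an arrival at [r] voids the rest. *)
Definition advance st (r : R) : state G :=
  last st [seq s <- complete st | now s <= r].

Definition run st J : state G :=
  foldl (fun s q => arrive (advance s (release q)) q) st J.

Definition service_algorithm I : schedule G :=
  if I is q :: _ then log (finish (run (init_state G (release q)) I))
  else [::].

Lemma now_step st st' : step st st' -> now st <= now st'.
Proof. by case. Qed.

Lemma reqs_step st st' : step st st' -> reqs st' = reqs st.
Proof. by case. Qed.

Lemma reqs_chain st p : chain st p -> reqs (last st p) = reqs st.
Proof.
by elim: p st => //= s p IH st [ns cp]; rewrite IH// (reqs_step ns).
Qed.

Lemma reqs_arrive st q : reqs (arrive st q) = rcons (reqs st) q.
Proof. by rewrite /arrive; case: pickP. Qed.

Lemma now_arrive st q : now (arrive st q) = release q.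
Proof. by rewrite /arrive; case: pickP. Qed.

Lemma reachable_chain t0 st p : reachable t0 st -> chain st p ->
  reachable t0 (last st p).
Proof.
by elim: p st => //= s p IH st rst [ns cp]; apply: IH => //; apply: reach_step ns.
Qed.

Lemma chain_now st p (r : R) : chain st p -> r < now st ->
  all (fun s => r < now s) p.
Proof.
elim: p st => //= s p IH st [ns cp] rs.
have rs' : r < now s by apply: lt_le_trans (now_step ns).
by rewrite rs'; apply: IH cp rs'.
Qed.

Lemma chain_split st p (r : R) : chain st p -> now st <= r ->
  exists p1 p2, [/\ p = p1 ++ p2, [seq s <- p | now s <= r] = p1,
    all (fun s => r < now s) p2, chain st p1 & chain (last st p1) p2] /\
    now (last st p1) <= r.
Proof.
elim: p st => [|s p IH] st /=; first by exists [::], [::].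
move=> [ns cp] sr; case: ifP => [sr'|/negbT].
  have [p1 [p2 [[-> -> ? ? ?] ?]]] := IH _ cp sr'.
  by exists (s :: p1), p2.
rewrite -ltNge => rs; exists [::], (s :: p).
have h := chain_now cp rs.
have fe : [seq u <- p | now u <= r] = [::].
  by elim: (p) h => //= u p' IHp /andP[ru /IHp ->]; rewrite leNgt ru.
by split=> //; split; rewrite //= rs h.
Qed.

(** The load bounds at [r] come from the first cancelled service: it respects all budgets at a later
    time, and loads are monotone. If no service is cancelled, nothing is pending. *)
Lemma advanceP t0 st (r : R) : reachable t0 st -> now st <= r ->
  let st1 := advance st r in
  [/\ reachable t0 st1, reqs st1 = reqs st, now st1 <= r,
      (forall l, load (delay_of (reqs st1)) st1 l r <= budget G l)
    & exists p, [/\ chain st1 p, all (fun s => r < now s) p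
                  & finish st = last st1 p]].
Proof.
move=> rst sr st1.
have [cp pe] := completeP (reachable_wf rst).
have [p1 [p2 [[Ep Ef hp2 cp1 cp2] np1]]] := chain_split cp sr.
have E1 : st1 = last st p1 by rewrite /st1 /advance Ef.
have rst1 : reachable t0 st1 by rewrite E1; apply: reachable_chain.
rewrite -E1 in cp2 np1.
split=> //.
- by rewrite E1 reqs_chain.
- move=> l; case: p2 Ep hp2 cp2 => [|s p2] Ep hp2 cp2.
    suff -> : load (delay_of (reqs st1)) st1 l r = 0 by rewrite ltW ?budget_gt0.
    by move: pe; rewrite Ep cats0 -E1 /load => ->; rewrite big_nil.
  have /= /andP[rs _] := hp2.
  have [ns _] := cp2; case: ns rs => t m F asg tau nt ttau ldle _ _ _ _ /= rt.
  apply: le_trans (ldle l); apply: load_mono => i ip.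
  have w1 := reachable_wf rst1.
  apply: (delay_of_mono (wf_valid w1)); last exact: ltW.
  exact: le_trans (wf_pend_release w1 ip) np1.
- by exists p2; split=> //; rewrite /finish Ep last_cat -E1.
Qed.

Lemma run_reachable t0 st J : reachable t0 st -> valid_requests J ->
  path (fun x y => x <= y) (now st) [seq release q | q <- J] ->
  reachable t0 (run st J) /\ reqs (run st J) = reqs st ++ J.
Proof.
elim: J st => [|q J IH] st rst /= vJ; first by rewrite cats0.
move=> /andP[sq pJ].
have [r1 E1 n1 l1 _] := advanceP rst sq.
have [|i p E||r2 E2] := IH (arrive (advance st (release q)) q).
- by apply: reach_arrive => //; apply: (vJ 0%N).
- exact: (vJ i.+1).
- by rewrite now_arrive.
- by split=> //; rewrite E2 reqs_arrive E1 cat_rcons.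
Qed.

Lemma now_run st J : now (run st J) = last (now st) [seq release q | q <- J].
Proof.
by case/lastP: J => // J q; rewrite /run foldl_rcons now_arrive map_rcons last_rcons.
Qed.

Lemma executed_chain st p (t : R) : chain st p -> all (fun s => t < now s) p ->
  executed t (log (last st p)) = executed t (log st).
Proof.
elim: p st => //= s p IH st [ns cp] /andP[ts hp]; rewrite IH//.
case: ns ts => u m F asg tau _ _ _ _ _ _ _ /= tu.
rewrite /executed filter_cat.
have -> : [seq a <- [seq Action u v [seq i <- pend st | asg i == Some v]
                     | v <- enum F] | time a <= t] = [::].
  by elim: (enum _) => //= v e ->; rewrite leNgt tu.
by rewrite cats0.
Qed.

Lemma executed_arrive st q (t : R) : t < release q ->
  executed t (log (arrive st q)) = executed t (log st).
Proof.
move=> tq; rewrite /arrive; case: pickP => //= v _.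
by rewrite /executed filter_rcons /= leNgt tq.
Qed.

(** Replanning at a release later than [t] discards and adds only actions later than [t]. *)
Lemma executed_run t0 st J (t : R) : reachable t0 st -> valid_requests J ->
  path (fun x y => x <= y) (now st) [seq release q | q <- J] ->
  all (fun q => t < release q) J ->
  executed t (log (finish (run st J))) = executed t (log (finish st)).
Proof.
elim: J st => //= q J IH st rst vJ /andP[sq pJ] /andP[tq tJ].
have [r1 E1 n1 l1 [p [cp hp ->]]] := advanceP rst sq.
have r2 : reachable t0 (arrive (advance st (release q)) q).
  by apply: reach_arrive => //; apply: (vJ 0%N).
rewrite IH //; first last.
- by rewrite now_arrive.
- by move=> i u E; apply: (vJ i.+1).
have [cp' _] := completeP (reachable_wf r2).
rewrite /finish (executed_chain cp'); last first.
  by apply: chain_now cp' _; rewrite now_arrive.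
rewrite executed_arrive// (executed_chain cp)//.
by apply: sub_all hp => s; apply: lt_trans.
Qed.

Lemma revealed_prefix (t : R) I : valid_input I ->
  exists2 J, I = revealed t I ++ J & all (fun q => t < release q) J.
Proof.
move=> [so _]; elim: I so => [|q I IH] so; first by exists [::].
rewrite /revealed /=; case: ifP => [qt|/negbT].
  have [J E hJ] := IH (path_sorted so).
  by exists J => //; rewrite {1}E.
rewrite -ltNge => tq.
have h : all (fun p => t < release p) (q :: I).
  rewrite /= tq; apply: sub_all (order_path_min _ so); last first.
    by move=> a b c; apply: le_trans.
  by move=> p; apply: lt_le_trans.
exists (q :: I) => //.
suff -> : [seq p <- I | release p <= t] = [::] by [].
by elim: I h {IH so} => //= p I IH /and3P[tq' tp hI]; rewrite leNgt tp /= IH //= tq'.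
Qed.

Lemma path_release q J :
  sorted (fun p p' => release p <= release p') (q :: J) ->
  path (fun x y => x <= y) (release q) [seq release p | p <- q :: J].
Proof. by rewrite /= lexx path_map. Qed.

Lemma run_reachable_input q J : valid_input (q :: J) ->
  let st := run (init_state G (release q)) (q :: J) in
  reachable (release q) st /\ reqs st = q :: J.
Proof.
move=> vI; apply: run_reachable; first exact: reach_init.
  exact: valid_input_requests.
by apply: path_release; case: vI.
Qed.

Lemma finishP t0 st : reachable t0 st ->
  [/\ reachable t0 (finish st), reqs (finish st) = reqs st
    & pend (finish st) = [::]].
Proof.
move=> rst; have [cp pe] := completeP (reachable_wf rst).
by split=> //; [exact: reachable_chain|exact: reqs_chain].
Qed.

Lemma service_algorithm_feasible I : valid_input I ->
  feasible I (service_algorithm I).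
Proof.
case: I => [|q J] vI; first by split.
have [r1 E1] := run_reachable_input vI.
have [r2 E2 p2] := finishP r1; rewrite E1 in E2.
have w := reachable_wf r2.
split; first exact: wf_sorted w.
  by have := wf_served w; rewrite p2 cats0 E2.
apply: sub_all (wf_log w) => a /andP[_ ha].
apply/forallP => i; apply/implyP => ia.
by have := allP ha _ ia; rewrite E2 /release_of onth_tnth.
Qed.

Lemma executed_service_algorithm (t : R) I P J : valid_input I ->
  I = P ++ J -> all (fun q => t < release q) J ->
  executed t (service_algorithm I) =
  if P is q :: _ then executed t (log (finish (run (init_state G (release q)) P)))
  else [::].
Proof.
move=> vI EI hJ; have vr := valid_input_requests vI.
have [so _] := vI; move: vr so hJ {vI}; rewrite {}EI => vr so hJ.
have [vP vJ] := valid_requests_cat vr.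
case: P vr so vP => [|q P] vr so vP.
  case: J vr so vJ hJ => [//|q J] vr so vJ hJ.
  rewrite /service_algorithm (executed_run (reach_init G (release q)))//; last first.
    exact: path_release.
  have w := wf_init G (release q).
  have [cp _] := completeP w.
  have /= /andP[tq _] := hJ.
  by rewrite executed_chain //; apply: chain_now cp _.
have pP : path (fun x y => x <= y) (release q) [seq release p | p <- q :: P ++ J].
  exact: path_release.
rewrite -cat_cons map_cat cat_path in pP; have /andP[pP1 pP2] := pP.
have [r1 E1] := run_reachable (reach_init G (release q)) vP pP1.
rewrite -[service_algorithm _]/(log (finish
  (run (init_state G (release q)) ((q :: P) ++ J)))).
rewrite [run _ (_ ++ _)]foldl_cat.
by apply: executed_run r1 vJ _ hJ; rewrite now_run.
Qed.

Lemma service_algorithm_online : online_on service_algorithm.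
Proof.
split; first exact: service_algorithm_feasible.
move=> t I J vI vJ E.
have [I' EI hI] := revealed_prefix t vI.
have [J' EJ hJ] := revealed_prefix t vJ.
rewrite (executed_service_algorithm vI EI hI).
by rewrite (executed_service_algorithm vJ EJ hJ) E.
Qed.

End Online.

(** * Charging the services to a fixed offline schedule *)

HB.instance Definition _ (R : realType) (G : network R) :=
  gen_eqMixin (action G).

Section Charging.
Variables (R : realType) (G : network R).
Local Notation V := (vertex G).
Implicit Types (st : state G) (q : request G) (a : action G).

(** With [e] a delay or connection cost of the optimum, this turns a residual term of [price] into
    an increment of [charged]. *)
Lemma min_exc_le (p x c e : R) : c <= e ->
  Num.min (exc p x) (exc p c) <= Num.min (Num.max p x) e - Num.min p e.
Proof.
rewrite /exc /Num.min /Num.max => ce.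
by repeat case: ifPn; rewrite -?leNgt; lra.
Qed.

Variables (I : seq (request G)) (S : schedule G).
Hypothesis vI : valid_requests I.
Hypothesis feasS : feasible I S.
Local Notation d := (delay_of I).
Local Notation cn := (dist_of I).
Local Notation rel := (release_of I).

Lemma opt_serves i : (i < size I)%N ->
  exists2 a, a \in S & [/\ i \in served a, time a = service_time S i
                        & rel i <= time a].
Proof.
move=> iI; have [_ pS rS] := feasS.
have : i \in flatten [seq served a | a <- S].
  by rewrite (perm_mem pS) mem_iota add0n iI.
move=> /flatten_mapP[b bS ib].
have : b \in [seq a <- S | i \in served a] by rewrite mem_filter ib bS.
case E: [seq a <- S | i \in served a] => [//|a s] _.
have : a \in [seq a <- S | i \in served a] by rewrite E inE eqxx.
rewrite mem_filter => /andP[ia aS]; exists a => //; split=> //.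
  by rewrite /service_time E.
have /forallP/(_ (Ordinal iI))/implyP/(_ ia) := allP rS _ aS.
by rewrite /release_of -[i]/(nat_of_ord (Ordinal iI)) onth_tnth.
Qed.

Definition opt_delay i : R := d i (service_time S i).
(** For a feasible [S] the sum has a single term; the sum form lets it be exchanged with the sum
    over actions in the cost. *)
Definition opt_dist i : R := \sum_(a <- S | i \in served a) cn i (site a).
Definition opt_share i : R := opt_delay i + opt_dist i.

(* Raising the paid amount of [i] from [x] to [y] charges the optimum the
   increment of [charged i], so these charges telescope. *)
Definition charged i (x : R) : R :=
  Num.min x (opt_delay i) + Num.min x (opt_dist i).

Definition capped_opening l a : R :=
  Num.min (level_opening l (site a)) (budget G l).

Lemma opt_dist_ge0 i : 0 <= opt_dist i.
Proof. by apply: sumr_ge0 => a _; apply: dist_of_ge0. Qed.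

Lemma opt_delay_ge0 i : (i < size I)%N -> 0 <= opt_delay i.
Proof.
by move=> /opt_serves[a _ [_ at_ ra]]; apply: delay_of_ge0; rewrite -?at_.
Qed.

Lemma opt_share_ge0 i : (i < size I)%N -> 0 <= opt_share i.
Proof. by move=> iI; rewrite addr_ge0 ?opt_dist_ge0 ?opt_delay_ge0. Qed.

Lemma charged_ge0 i x : (i < size I)%N -> 0 <= x -> 0 <= charged i x.
Proof.
by move=> iI x0; rewrite addr_ge0// le_min x0 ?opt_dist_ge0 ?opt_delay_ge0.
Qed.

Lemma charged_mono i x y : x <= y -> charged i x <= charged i y.
Proof. by move=> xy; rewrite lerD// le_min2. Qed.

Lemma charged_le i x : charged i x <= opt_share i.
Proof. by rewrite lerD// ge_min lexx orbT. Qed.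

Lemma capped_opening_ge0 l a : 0 <= capped_opening l a.
Proof. by rewrite le_min level_opening_ge0 ltW ?budget_gt0. Qed.

Lemma opt_dist_le i a : a \in S -> i \in served a -> cn i (site a) <= opt_dist i.
Proof.
move=> aS ia; rewrite /opt_dist (big_rem a)//= ia lerDl.
by apply: sumr_ge0 => b _; apply: dist_of_ge0.
Qed.

Lemma sum_window_le (g : action G -> R) (T x y : R) : (forall a, 0 <= g a) ->
  T <= y -> x <= y ->
  \sum_(a <- S | time a < T) g a + \sum_(a <- S | T <= time a < x) g a <=
  \sum_(a <- S | time a < y) g a.
Proof.
move=> g0 Ty xy; rewrite big_mkcond [X in _ + X]big_mkcond [leRHS]big_mkcond.
rewrite -big_split /=; apply: ler_sum => a _.
case: (ltP (time a) T) => aT /=; first by rewrite addr0 (lt_le_trans aT Ty).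
rewrite add0r; case: ifP => [ax|_]; first by rewrite (lt_le_trans ax xy).
by case: ifP.
Qed.

(* What the optimum does within the window, together with the delay it incurs,
   is a candidate solution for the prize-collecting problem of the service. *)
Lemma window_charge st m (T tau : R) :
  {in pend st, forall i, (i < size I)%N} ->
  {in pend st, forall i, rel i <= tau} ->
  {in pend st, forall i, (lev st i <= m)%N -> T <= rel i} ->
  (forall F, budget G m <= price d cn st m F tau) ->
  budget G m <= \sum_(a <- S | T <= time a < tau) capped_opening m a +
    \sum_(i <- pend st | (lev st i <= m)%N)
      (charged i (Num.max (paid st i) (d i tau)) - charged i (paid st i)).
Proof.
move=> hI hr hT hp.
have inc0 i : 0 <= charged i (Num.max (paid st i) (d i tau)) - charged i (paid st i).
  by rewrite subr_ge0 charged_mono// le_max lexx.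
pose W := [seq a <- S | T <= time a < tau].
(* One facility in the window whose discounted price reaches the budget suffices alone. Otherwise no
   cap is active and the sites of the window serve as [F]. *)
case: (boolP (has (fun a => budget G m <= level_opening m (site a)) W)).
  move=> /hasP[a aW ha]; rewrite -big_filter -/W (big_rem a)//= -addrA.
  rewrite {1}/capped_opening min_r// lerDl addr_ge0//.
    by apply: sumr_ge0 => b _; apply: capped_opening_ge0.
  by apply: sumr_ge0.
move=> /hasPn cheap.
apply: le_trans (hp [set x in [seq site a | a <- W]]%SET) _.
apply: lerD.
  apply: le_trans (sum_set_seq_le _ _) _; first exact: level_opening_ge0.
  rewrite big_map -[leRHS]big_filter -/W big_seq [leRHS]big_seq.
  apply: ler_sum => a /cheap; rewrite -ltNge => ha.
  by rewrite /capped_opening min_l// ltW.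
rewrite big_seq_cond [leRHS]big_seq_cond; apply: ler_sum => i /andP[ip im].
have [a aS [ia at_ ra]] := opt_serves (hI i ip).
(* Served before [tau], the request is connected within the window, as [T <= rel i]; served later,
   it has cost the optimum its delay up to [tau]. *)
have [ataul|taua] := ltP (time a) tau.
  have aW : a \in W by rewrite mem_filter ataul (le_trans (hT i ip im) ra).
  have sF : site a \in [set x in [seq site a | a <- W]]%SET.
    by rewrite finset.inE map_f.
  apply: (le_trans (y := Num.min (exc (paid st i) (d i tau))
                       (exc (paid st i) (cn i (site a))))).
    rewrite le_min bigmin_le_id /=.
    exact: (bigmin_le_cond _ (fun v => exc (paid st i) (cn i v)) sF).
  apply: le_trans (min_exc_le _ _ (opt_dist_le aS ia)) _.
  rewrite /charged opprD addrACA lerDr subr_ge0 le_min2//.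
  by rewrite le_max lexx.
apply: le_trans (bigmin_le_id _ _ _ _) _.
have : d i tau <= opt_delay i.
  by rewrite /opt_delay -at_; apply: delay_of_mono => //; apply: hr.
move=> /min_exc_le - /(_ (paid st i) (d i tau)); rewrite minxx => h.
apply: le_trans h _.
rewrite /charged opprD addrACA lerDl subr_ge0 le_min2//.
by rewrite le_max lexx.
Qed.

(* Each service of level [l.+1] is charged to an earlier service of level [l].
   [T] is the time of the last service of level [l.+1]; of the charges
   [Y] made to requests by services of level [l], the part [Z] is already used.
   A request that waits at level [l.+1] certifies that the optimum spent
   [budget l] on fresh facilities and charges by the time [tau] up to which its
   delay is paid, hence before the next service it can trigger. *)
Definition level_inv st l (Y : R) : Prop :=
  exists T Z : R, [/\ T <= now st, Z <= Y,
    budget G l *+ count_mem l.+1 (hist st) <=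
      \sum_(a <- S | time a < T) capped_opening l a + Z,
    {in pend st, forall i, (lev st i <= l.+1)%N -> T <= rel i}
  & {in pend st, forall i, lev st i = l.+1 -> exists tau,
      [/\ rel i <= tau, d i tau <= paid st i
        & budget G l <= \sum_(a <- S | T <= time a < tau) capped_opening l a
                        + (Y - Z)]}].

Definition charge_inv st : Prop := exists Y : nat -> R,
  (forall L, \sum_(l < L) Y l +
     \sum_(i <- pend st) (opt_share i - charged i (paid st i)) <=
     \sum_(i < size (reqs st)) opt_share i) /\
  forall l, level_inv st l (Y l).

(* A request at level 0 arrived after the last service, and serving it costs the
   optimum at least [budget 0]. *)
Definition base_inv st : Prop := exists T : R, [/\ T <= now st,
    {in pend st, forall i, lev st i = 0%N -> T <= rel i}
  & budget G 0 *+ count_mem 0%N (hist st) +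
      \sum_(i <- pend st | lev st i == 0%N) opt_share i <=
    \sum_(a <- S | time a < T) opening (site a) +
      \sum_(i < size (reqs st)) opt_share i].

Definition action_cost a : R :=
  opening (site a) + \sum_(i <- served a) (cn i (site a) + d i (time a)).

(** Twice the paid amount is a potential: one copy goes to the connection and one to the delay when
    the request is finally served. *)
Definition cost_inv st : Prop :=
  \sum_(a <- log st) action_cost a + \sum_(i <- pend st) 2 * paid st i <=
  2 * \sum_(i < size (reqs st)) d i (rel i) +
  4 * \sum_(m <- hist st) budget G m.

Section ServiceStep.
Variables (st st' : state G).
Hypothesis pend_size : {in pend st, forall i, (i < size I)%N}.
Hypothesis pend_rel : {in pend st, forall i, rel i <= now st}.
Hypothesis pend_paid : {in pend st, forall i, 0 <= paid st i}.
Hypothesis pend_unit :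
  {in pend st, forall i v, unit_cost G <= opening v + cn i v}.
Hypothesis hserv : service d cn st st'.

(** At [l = m] the service issues certificates to the raised requests, by [window_charge]. At
    [l.+1 = m] it redeems one, and the window restarts at [t] with all of [Y l] used. *)
Lemma charge_inv_step : charge_inv st -> charge_inv st'.
Proof.
case: hserv => t m F asg tau nt ttau ldle ldeq has hp hor [Y [hY hl]].
pose inc i := charged i (Num.max (paid st i) (d i tau)) - charged i (paid st i).
pose incm := \sum_(i <- pend st | (lev st i <= m)%N) inc i.
have inc0 i : 0 <= inc i by rewrite subr_ge0 charged_mono// le_max lexx.
have incm0 : 0 <= incm by apply: sumr_ge0.
exists (fun l => Y l + if l == m then incm else 0); split=> [L|l] /=.
  apply: le_trans (hY L); rewrite big_split/= -addrA lerD2l.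
  apply: le_trans (_ : _ <= incm + \sum_(i <- pend st | asg i == None)
      (opt_share i - charged i (if (i \in pend st) && (lev st i <= m)%N
        then Num.max (paid st i) (d i tau) else paid st i))) _.
    rewrite big_filter lerD2r.
    have [mL|Lm] := ltnP m L.
      rewrite (bigD1 (Ordinal mL))//= eqxx big1 ?addr0// => l.
      by rewrite -val_eqE /= => /negPf ->.
    by rewrite big1// => l _; rewrite ltn_eqF// (leq_trans (ltn_ord l)).
  rewrite /incm big_mkcond [X in _ + X]big_mkcond -big_split /=.
  rewrite big_seq [leRHS]big_seq; apply: ler_sum => i ip; rewrite ip /=.
  case: (leqP (lev st i) m) => im.
    case: (asg i == None); first by rewrite /inc; lra.
    by rewrite addr0 /inc lerB// charged_le.
  rewrite add0r; case E: (asg i) => [v|//].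
  by have [_] := has _ _ E; rewrite leqNgt im.
have [T [Z [Tn ZY hN hT hc]]] := hl l.
have [lm|ml|lm] := ltngtP l m.
- (* a higher service clears all levels up to [l.+1] *)
  have none i : i \in [seq i <- pend st | asg i == None] ->
      (l.+1 < if (i \in pend st) && (lev st i <= m)%N then m.+1 else lev st i)%N.
    rewrite mem_filter => /andP[_ ip]; rewrite ip /=.
    by case: (leqP (lev st i) m) => h; rewrite ?ltnS//; apply: leq_ltn_trans lm h.
  have [ml|ml] := eqVneq m l.+1; last first.
    exists T, Z; rewrite addr0; split=> //=.
    + exact: le_trans nt.
    + by rewrite (negPf ml) add0n.
    + by move=> i /none; rewrite ltnNge => /negPf ->.
    + by move=> i /none + E; rewrite E ltnn.
  exists t, (Y l); rewrite addr0; split=> //=.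
  + rewrite ml eqxx add1n mulrS.
    (* Otherwise the load would come from levels at most [l] and stay within [budget G l], half of
       what triggered. *)
    have [i ip [il ei]] : exists2 i, i \in pend st & lev st i = l.+1 /\
        paid st i < d i t.
      apply/not_exists2P => h; suff : load d st m t <= budget G l.
        by rewrite ldeq ml budgetS; have := budget_gt0 G l; lra.
      apply: le_trans (ldle l); rewrite /load big_mkcond [leRHS]big_mkcond.
      rewrite big_seq [leRHS]big_seq; apply: ler_sum => i ip.
      rewrite ml leq_eqVlt ltnS; case: eqVneq => [E|_] //=.
      rewrite E ltnn exc_eq0// leNgt; apply/negP => h'.
      by case: (h i) => [/(_ ip)//|[]].
    have [tau' [rt dt hb]] := hc i ip il.
    (* The delay at [tau'] is paid and the delay at [t] is not. *)
    have tau't : tau' <= t.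
      rewrite leNgt; apply/negP => h; move: ei; apply/negP; rewrite -leNgt.
      apply: le_trans dt; apply: delay_of_mono => //; last exact: ltW.
      by apply: le_trans nt; apply: pend_rel.
    have := @sum_window_le (capped_opening l) T tau' t
      (capped_opening_ge0 l) (le_trans Tn nt) tau't.
    by move: hN hb; lra.
  + by move=> i /none; rewrite ltnNge => /negPf ->.
  + by move=> i /none + E; rewrite E ltnn.
(* A lower service raises requests to level [l] at most, which requires no certificate. *)
- exists T, Z; rewrite addr0; split=> //=.
  + exact: le_trans nt.
  + by rewrite ltn_eqF ?add0n// ltnW.
  + move=> i; rewrite mem_filter => /andP[_ ip]; rewrite ip /=.
    case: (leqP (lev st i) m) => im h; apply: hT => //.
    by apply: leq_trans im _; apply: ltnW; apply: ltnW.
  + move=> i; rewrite mem_filter => /andP[_ ip]; rewrite ip /=.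
    case: (leqP (lev st i) m) => im h; last exact: hc.
    by case: h ml => ->; rewrite ltnn.
- subst m.
  exists T, Z; split=> //=.
  + exact: le_trans nt.
  + by rewrite (le_trans ZY)// lerDl.
  + by rewrite ltn_eqF ?add0n.
  + move=> i; rewrite mem_filter => /andP[_ ip]; rewrite ip /=.
    case: (leqP (lev st i) l) => il h; apply: hT => //.
    exact: leq_trans il _.
  + move=> i; rewrite mem_filter => /andP[/eqP ai ip]; rewrite ip /=.
    case: (leqP (lev st i) l) => il h; last first.
      have [tau' [? ? h']] := hc i ip h; exists tau'; split=> //.
      by apply: le_trans h' _; rewrite lerD2l lerD2r lerDl.
    have rt : {in pend st, forall i, rel i <= tau}.
      move=> j jp; apply: le_trans ttau; apply: le_trans nt; exact: pend_rel.
    exists tau; split; [exact: rt|by rewrite le_max lexx orbT|].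
    case: hor => [/(_ i ip il)|hF]; first by rewrite ai.
    apply: le_trans (@window_charge st l T tau pend_size rt _ hF) _.
      by move=> j jp jl; apply: hT => //; apply: leq_trans jl _.
    by rewrite lerD2l -[leLHS]/incm; move: ZY; lra.
Qed.

(** Either the optimum served a level-0 request before [t], spending at least [unit_cost], or it
    makes all of them wait and bears the whole load. Every service empties level 0, so no share is
    used twice. *)
Lemma base_inv_step : base_inv st -> base_inv st'.
Proof.
case: hserv => t m F asg tau nt ttau ldle ldeq has hp hor [T [Tn hT hN]].
have none i : i \in [seq i <- pend st | asg i == None] ->
    (if (i \in pend st) && (lev st i <= m)%N then m.+1 else lev st i) <> 0%N.
  rewrite mem_filter => /andP[_ ip]; rewrite ip /=.
  by case: ifP => // h E; rewrite E in h.
have none' : \sum_(i <- [seq i <- pend st | asg i == None] |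
    (if (i \in pend st) && (lev st i <= m)%N then m.+1 else lev st i) == 0%N)
    opt_share i = 0.
  by rewrite big_seq_cond big1 // => i /andP[/none + /eqP].
have s0 : 0 <= \sum_(i <- pend st | lev st i == 0%N) opt_share i.
  rewrite big_seq_cond; apply: sumr_ge0 => i /andP[ip _].
  exact/opt_share_ge0/pend_size.
exists t; split=> //=; first by move=> i /none.
rewrite none' addr0.
have win0 x : T <= x -> x <= t -> 
    \sum_(a <- S | time a < T) opening (site a) +
    \sum_(a <- S | T <= time a < x) opening (site a) <=
    \sum_(a <- S | time a < t) opening (site a).
  move=> Tx xt; apply: sum_window_le => //; first by move=> a; apply: opening_ge0.
  exact: le_trans xt.
have [m0|m0] := eqVneq m 0%N; last first.
  rewrite add0n.
  have := win0 T (lexx T) (le_trans Tn nt).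
  rewrite [X in _ + X <= _]big1 ?addr0; last first.
    by move=> a /andP[h1 h2]; move: (le_lt_trans h1 h2); rewrite ltxx.
  by move: hN s0; lra.
rewrite add1n mulrS; rewrite m0 in ldeq.
suff : budget G 0 <= \sum_(a <- S | T <= time a < t) opening (site a) +
    \sum_(i <- pend st | lev st i == 0%N) opt_share i.
  by have := win0 t (le_trans Tn nt) (lexx t); move: hN; lra.
case: (pselect (exists2 i, (i \in pend st) && (lev st i == 0%N) &
    service_time S i < t)) => [[i /andP[ip /eqP il] it_]|h].
  have [a aS [ia at_ ra]] := opt_serves (pend_size ip).
  have -> : budget G 0 = unit_cost G by rewrite /budget expr0 mulr1.
  apply: le_trans (pend_unit ip (site a)) _; apply: lerD.
    rewrite (big_rem a)//= at_ it_ -at_ (le_trans (hT i ip il) ra) /= lerDl.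
    by apply: sumr_ge0 => b _; apply: opening_ge0.
  rewrite (big_rem i)//= il eqxx.
  apply: le_trans (_ : opt_share i <= _).
    apply: le_trans (opt_dist_le aS ia) _.
    by rewrite lerDr opt_delay_ge0// pend_size.
  rewrite lerDl big_seq_cond; apply: sumr_ge0 => j /andP[/mem_rem jp _].
  exact/opt_share_ge0/pend_size.
rewrite -ldeq /load -[leLHS]add0r; apply: lerD.
  by apply: sumr_ge0 => a _; apply: opening_ge0.
under [leLHS]eq_bigl do rewrite leqn0.
rewrite big_seq_cond [leRHS]big_seq_cond; apply: ler_sum => i /andP[ip il].
have rt : rel i <= t by apply: le_trans nt; apply: pend_rel.
apply: le_trans (exc_le_arg _ _) _; first exact: pend_paid.
  exact: delay_of_ge0.
apply: le_trans (_ : opt_delay i <= _); last first.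
  by rewrite lerDl opt_dist_ge0.
apply: delay_of_mono => //; rewrite leNgt; apply/negP => it_.
by apply: h; exists i => //; rewrite ip il.
Qed.

(** Four budgets: one for the discount on openings, two for openings and residual charges counted at
    most twice, and one for the load at [t], which covers the unpaid delay of the served
    requests. *)
Lemma cost_inv_step : cost_inv st -> cost_inv st'.
Proof.
case: hserv => t m F asg tau nt ttau ldle ldeq has hp hor; rewrite /cost_inv /=.
move=> hc; rewrite big_cat big_cons big_map big_enum /=.
rewrite [X in _ + X + _]big_split /=.
under [X in _ + (_ + X)]eq_bigr => v _ do rewrite big_filter.
rewrite (@sum_assigned _ _ _ _ _ (fun i v => cn i v + d i t)); last first.
  by move=> i v /has[].
rewrite [X in _ + X <= _]big_filter.
set A1 := \sum_(a <- log st) _ in hc *; set P0 := \sum_(i <- pend st) _ in hc.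
set E1 := \sum_(i <- pend st | (lev st i <= m)%N) _ in hp.
suff : \sum_(i <- pend st) (if asg i is Some v then cn i v + d i t else 0) +
   \sum_(i <- pend st | asg i == None) 2 *
     (if (i \in pend st) && (lev st i <= m)%N then Num.max (paid st i) (d i tau)
      else paid st i) <= P0 + 2 * E1 + load d st m t.
  have := sum_opening_le m F; rewrite ldeq; move: hc hp.
  have : 0 <= \sum_(v in F) level_opening m v.
    by apply: sumr_ge0 => v _; apply: level_opening_ge0.
  by rewrite mulrDr; lra.
rewrite /P0 /E1 /load mulr_sumr big_mkcond /=.
rewrite [X in _ + X <= _]big_mkcond -big_split /=.
rewrite [X in _ + X + _ ]big_mkcond [X in _ <= _ + X]big_mkcond -!big_split /=.
rewrite big_seq [leRHS]big_seq; apply: ler_sum => i ip; rewrite ip /=.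
have e0 x := exc_ge0 (paid st i) x.
have e1 x := le_exc (paid st i) x.
have e2 x := max_exc (paid st i) x.
case E: (asg i) => [v|] /=.
  have [_ -> _] := has _ _ E.
  by have := e1 (cn i v); have := e1 (d i t); have := e0 (cn i v); lra.
case: ifP => _; last by lra.
by rewrite e2; have := e0 (d i t); lra.
Qed.

End ServiceStep.
End Charging.

(** * Preservation of the invariants by arrivals *)

Section Arrival.
Variables (R : realType) (G : network R).
Local Notation V := (vertex G).
Implicit Types (st : state G) (q : request G) (a : action G).

Lemma hist_arrive st q : hist (arrive st q) = hist st.
Proof. by rewrite /arrive; case: pickP. Qed.

Lemma mem_pend_arrive st q j : wf st -> j \in pend (arrive st q) ->
  [/\ j \in pend st, lev (arrive st q) j = lev st j
    & paid (arrive st q) j = paid st j] \/ j = size (reqs st).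
Proof.
move=> w; rewrite /arrive; case: pickP => /= [v _|_]; first by left.
rewrite inE; case: eqVneq => [-> _|_ /= jp]; by [right|left].
Qed.

Lemma lev_arrive st q : size (reqs st) \in pend (arrive st q) -> wf st ->
  lev (arrive st q) (size (reqs st)) = 0%N.
Proof.
rewrite /arrive; case: pickP => /= [v _|_ _ _]; last by rewrite eqxx.
by move=> h w; have := wf_size w h; rewrite ltnn.
Qed.

Lemma sum_pend_arrive (g : nat -> nat -> R -> R) st q : wf st ->
  0 <= g (size (reqs st)) 0%N (delay q (release q)) ->
  \sum_(j <- pend (arrive st q)) g j (lev (arrive st q) j) (paid (arrive st q) j)
  <= \sum_(j <- pend st) g j (lev st j) (paid st j) +
     g (size (reqs st)) 0%N (delay q (release q)).
Proof.
move=> w g0; rewrite /arrive; case: pickP => [v _|_] /=; first by rewrite lerDl.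
rewrite big_cons !eqxx addrC lerD2r big_seq [leRHS]big_seq.
by apply: ler_sum => j /(wf_size w) jn; rewrite ltn_eqF.
Qed.

Variables (I : seq (request G)) (S : schedule G).
Hypothesis vI : valid_requests I.
Hypothesis feasS : feasible I S.

Section Step.
Variables (st : state G) (q : request G) (J : seq (request G)).
Hypothesis EI : I = rcons (reqs st) q ++ J.
Hypothesis wst : wf st.
Hypothesis nq : now st <= release q.
Local Notation i0 := (size (reqs st)).

Let onq : onth I i0 = Some q.
Proof. by rewrite EI cat_rcons onth_cat ltnn subnn. Qed.

Let i0I : (i0 < size I)%N.
Proof. by rewrite -onthTE onq. Qed.

Lemma release_new : release_of I i0 = release q.
Proof. by rewrite /release_of onq. Qed.

Lemma delay_new (t : R) : delay_of I i0 t = delay q t.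
Proof. by rewrite /delay_of onq. Qed.

Let delay_ge0 : 0 <= delay q (release q).
Proof. by case: (vI onq). Qed.

Lemma charge_inv_arrive : charge_inv I S st -> charge_inv I S (arrive st q).
Proof.
move=> [Y [hY hl]]; exists Y; split=> [L|l].
  rewrite reqs_arrive size_rcons big_ord_recr /=.
  have := @sum_pend_arrive (fun j _ x => opt_share I S j - charged I S j x) st q wst.
  have c0 : charged I S i0 (delay q (release q)) <= opt_share I S i0.
    exact: charged_le.
  rewrite subr_ge0 => /(_ c0); have := charged_ge0 vI feasS i0I delay_ge0.
  by move: (hY L); lra.
have [T [Z [Tn ZY hN hT hc]]] := hl l.
exists T, Z; rewrite now_arrive hist_arrive; split=> //.
- exact: le_trans nq.
- move=> j jp; case: (mem_pend_arrive wst jp) => [[jp' -> _]|->]; first exact: hT.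
  by move=> _; rewrite release_new (le_trans Tn nq).
- move=> j jp; case: (mem_pend_arrive wst jp) => [[jp' -> ->]|E]; first exact: hc.
  by rewrite E lev_arrive // -E.
Qed.

Lemma base_inv_arrive : base_inv I S st -> base_inv I S (arrive st q).
Proof.
move=> [T [Tn hT hN]]; exists T; rewrite now_arrive hist_arrive; split=> //.
- exact: le_trans nq.
- move=> j jp; case: (mem_pend_arrive wst jp) => [[jp' -> _]|->]; first exact: hT.
  by move=> _; rewrite release_new (le_trans Tn nq).
- rewrite reqs_arrive size_rcons big_ord_recr /=.
  have := @sum_pend_arrive (fun j k _ => if k == 0%N then opt_share I S j else 0)
    st q wst (opt_share_ge0 vI feasS i0I).
  by rewrite /= -!big_mkcond /=; move: hN; lra.
Qed.

Lemma cost_inv_arrive : cost_inv I st -> cost_inv I (arrive st q).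
Proof.
rewrite /cost_inv reqs_arrive hist_arrive size_rcons big_ord_recr /=.
rewrite release_new delay_new => hc; rewrite /arrive.
case: pickP => [v /eqP v0|_] /=.
  rewrite big_rcons /= /action_cost /= big_seq1 /dist_of onq delay_new.
  by move: hc v0 delay_ge0; lra.
rewrite big_cons eqxx.
have -> : \sum_(j <- pend st) 2 * (if j == i0 then delay q (release q) else paid st j)
    = \sum_(j <- pend st) 2 * paid st j.
  apply: eq_big_seq => j /(wf_size wst) jn; by rewrite ltn_eqF.
by move: hc; lra.
Qed.

End Step.

Lemma service_prefix st st' J : I = reqs st ++ J -> wf st -> step st st' ->
  service (delay_of I) (dist_of I) st st'.
Proof.
move=> EI w; apply: service_ext => i ip; rewrite EI.
  by rewrite delay_of_cat // wf_size.
by rewrite dist_of_cat // wf_size.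
Qed.

(** Delays and shares refer to the complete input, of which [reqs st] is a prefix, so the comparison
    is with one offline schedule throughout. *)
Lemma reachable_inv t0 st : reachable t0 st ->
  forall J, I = reqs st ++ J ->
  [/\ cost_inv I st, base_inv I S st & charge_inv I S st].
Proof.
elim=> [|s s' rs IH hs|s q rs IH nq vq hl] J EI.
- split.
  + by rewrite /cost_inv /= !big_nil big_ord0 !mulr0 addr0.
  + exists t0; split=> //=; rewrite big_nil big_ord0 !addr0 mulr0n.
    by apply: sumr_ge0 => a _; apply: opening_ge0.
  + exists (fun=> 0); split=> [L|l] /=.
      by rewrite big_nil big_ord0 addr0 big1.
    exists t0, 0; split=> //=; rewrite mulr0n addr0.
    by apply: sumr_ge0 => a _; apply: capped_opening_ge0.
- have w := reachable_wf rs.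
  rewrite (reqs_step hs) in EI; have [h1 h2 h3] := IH _ EI.
  have hserv := service_prefix EI w hs.
  have psize : {in pend s, forall i, (i < size I)%N}.
    by move=> i ip; rewrite EI size_cat ltn_addr// wf_size.
  have prel : {in pend s, forall i, release_of I i <= now s}.
    by move=> i ip; rewrite EI release_of_cat ?wf_size// wf_pend_release.
  have punit : {in pend s, forall i v, unit_cost G <= opening v + dist_of I i v}.
    by move=> i ip v; rewrite EI dist_of_cat ?wf_size// wf_unit_cost.
  split.
  + exact: cost_inv_step hserv h1.
  + exact: (base_inv_step vI feasS psize prel (wf_paid w) punit hserv).
  + exact: (charge_inv_step vI feasS psize prel hserv).
- rewrite reqs_arrive in EI; have w := reachable_wf rs.
  have [|h1 h2 h3] := IH (q :: J); first by rewrite EI cat_rcons.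
  split; [exact: cost_inv_arrive EI w h1|exact: base_inv_arrive EI w nq h2|].
  exact: charge_inv_arrive EI w nq h3.
Qed.

End Arrival.

(** * The competitive ratio *)

Section Competitiveness.
Variables (R : realType) (G : network R).
Local Notation V := (vertex G).
Implicit Types (a : action G).

Lemma sum_ord_mem (Z : nmodType) (n : nat) (s : seq nat) (g : nat -> Z) :
  uniq s -> {subset s <= iota 0 n} ->
  \sum_(i < n | (i : nat) \in s) g i = \sum_(i <- s) g i.
Proof.
move=> us sn; rewrite -(big_mkord (fun i => i \in s) g) -big_filter.
apply: perm_big; apply: uniq_perm => //; first exact/filter_uniq/iota_uniq.
move=> i; rewrite mem_filter /index_iota subn0.
by case: (boolP (i \in s)) => // /sn ->.
Qed.

Lemma service_time_eq (T : schedule G) i a : uniq (flatten [seq served b | b <- T]) ->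
  a \in T -> i \in served a -> service_time T i = time a.
Proof.
rewrite /service_time; elim: T => //= b T IH.
rewrite cat_uniq => /and3P[ub /hasPn disj uT]; rewrite inE => aT ia.
case: ifP => [ib|/negbT ib] /=.
  case/predU1P: aT => [->//|aT].
  have /disj : i \in flatten [seq served b | b <- T] by apply/flatten_mapP; exists a.
  by rewrite /= ib.
case/predU1P: aT => [ab|aT]; last exact: IH.
by rewrite ab (negPf ib) in ia.
Qed.

Lemma cost_functions (I : seq (request G)) (T : schedule G) : cost I T =
  \sum_(a <- T) (opening (site a) +
     \sum_(i < size I | (i : nat) \in served a) dist_of I i (site a)) +
  \sum_(i < size I) delay_of I i (service_time T i).
Proof.
rewrite /cost; congr (_ + _).
  apply: eq_bigr => a _; congr (_ + _); apply: eq_bigr => i _.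
  by rewrite /dist_of onth_tnth.
by apply: eq_bigr => i _; rewrite /delay_of onth_tnth.
Qed.

Lemma cost_actions (I : seq (request G)) (T : schedule G) : feasible I T ->
  cost I T = \sum_(a <- T) action_cost I a.
Proof.
move=> [_ pT _]; rewrite cost_functions.
have uT : uniq (flatten [seq served a | a <- T]) by rewrite (perm_uniq pT) iota_uniq.
have -> : \sum_(i < size I) delay_of I i (service_time T i) =
    \sum_(a <- T) \sum_(i <- served a) delay_of I i (time a).
  rewrite -(big_mkord xpredT (fun i => delay_of I i (service_time T i))).
  rewrite /index_iota subn0 -(perm_big _ pT) big_flatten big_map /=.
  apply: eq_big_seq => a aT; apply: eq_big_seq => i ia.
  by rewrite (service_time_eq uT aT ia).
rewrite -big_split /=; apply: eq_big_seq => a aT.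
rewrite /action_cost big_split /= addrA; congr (_ + _ + _).
rewrite (@sum_ord_mem _ _ _ (fun i => dist_of I i (site a)))//.
  case/splitPr: aT uT => T1 T2.
  by rewrite map_cat flatten_cat /= !cat_uniq => /and3P[_ _ /and3P[]].
move=> i ia; rewrite -(perm_mem pT).
by apply/flatten_mapP; exists a.
Qed.

Lemma cost_shares (I : seq (request G)) (T : schedule G) :
  cost I T = \sum_(a <- T) opening (site a) + \sum_(i < size I) opt_share I T i.
Proof.
rewrite cost_functions [in LHS]big_split /= -addrA; congr (_ + _).
rewrite (exchange_big_dep predT)//= -big_split /=.
by apply: eq_bigr => i _; rewrite addrC.
Qed.

Lemma sum_budget_le n : \sum_(0 <= l < n) budget G l <= budget G n.
Proof.
elim: n => [|n IH]; first by rewrite big_geq// ltW ?budget_gt0.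
by rewrite big_nat_recr//= budgetS; move: IH; lra.
Qed.

(** Let [l1] be the first level whose budget reaches the cost [f]. The budgets below [l1] sum
    geometrically to at most [2 f], the next [k] levels charge at most [f] each, and from [l1 + k]
    on the facility is free because [2 ^ k] is at least [#|V|]. *)
Lemma sum_capped_opening_le L a :
  \sum_(l < L) capped_opening l a <=
  (up_log 2 #|V| + 2)%:R * opening (site a).
Proof.
set k := up_log 2 _; set f := opening (site a).
have f0 : 0 <= f by apply: opening_ge0.
have cf l : capped_opening l a <= f.
  by rewrite ge_min level_opening_le.
move: f0; rewrite le_eqVlt => /orP[/eqP f0|f0].
  rewrite -f0 mulr0; apply: sumr_le0 => l _.
  by rewrite f0; apply: cf.
have [l1 hl1 min1] : exists2 l1, f <= budget G l1 &
    forall l, f <= budget G l -> (l1 <= l)%N.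
  have ex : exists l, f <= budget G l.
    by have [l /ltW] := budget_unbounded G f; exists l.
  by case: (ex_minnP ex) => l1; exists l1.
have free l : (l1 + k <= l)%N -> capped_opening l a = 0.
  move=> hl; rewrite /capped_opening /level_opening ifT.
    by rewrite min_l// ltW ?budget_gt0.
  apply: le_trans (budget_le G hl); rewrite /budget exprD mulrA -/(budget G l1).
  rewrite mulrC ler_pM ?ler0n//; first exact: ltW.
  by rewrite -natrX ler_nat up_logP.
rewrite -(big_mkord xpredT (fun l => capped_opening l a)).
apply: (le_trans (y := \sum_(0 <= l < l1 + k + L) capped_opening l a)).
  rewrite [leRHS](big_cat_nat (n := L))//= ?leq_addl//.
  by rewrite lerDl; apply: sumr_ge0 => l _; apply: capped_opening_ge0.
rewrite (big_cat_nat (n := l1 + k))//= ?leq_addr//.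
rewrite [X in _ + X]big_nat_cond [X in _ + X]big1 ?addr0; last first.
  by move=> l /andP[/andP[hl _] _]; apply: free.
rewrite (big_cat_nat (n := l1))//= ?leq_addr// natrD mulrDl addrC.
apply: lerD.
  apply: le_trans (ler_sum _ (fun l _ => cf l)) _.
  by rewrite sumr_const_nat addKn mulr_natl.
apply: (le_trans (y := \sum_(0 <= l < l1) budget G l)).
  by apply: ler_sum => l _; rewrite ge_min lexx orbT.
case: l1 {free hl1} min1 => [|l1] min1.
  by rewrite big_geq// mulr_ge0// ltW.
apply: le_trans (sum_budget_le _) _; rewrite budgetS ler_pM2l//.
by rewrite leNgt; apply/negP => /ltW/min1; rewrite ltnn.
Qed.

Lemma sum_by_count (s : seq nat) K (g : nat -> R) : all (fun m => m < K)%N s ->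
  \sum_(m <- s) g m = \sum_(l < K) g l *+ count_mem (l : nat) s.
Proof.
elim: s => [_|m s IH /= /andP[mK hs]].
  by rewrite big_nil big1// => l _; rewrite mulr0n.
rewrite big_cons IH//; under [RHS]eq_bigr do rewrite mulrnDr.
rewrite big_split /=; congr (_ + _).
rewrite (bigD1 (Ordinal mK))//= eqxx mulr1n big1 ?addr0// => l.
by rewrite -val_eqE /= eq_sym => /negPf ->; rewrite mulr0n.
Qed.

(** With total openings [f] and shares [s] of the offline schedule and [k] the rounded-up logarithm,
    the bound is [2 s + 4 ((f + s) + 2 ((k + 2) f + s))]. The inner terms are level 0 and the levels
    [l.+1], whose budgets are twice those charged. *)
Lemma service_algorithm_competitive :
  competitive_on (8 * (up_log 2 #|V|)%:R + 22) (@service_algorithm R G).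
Proof.
move=> I vI; have feasA := service_algorithm_feasible vI.
set alpha : R := _ + _.
have alpha0 : 0 < alpha by rewrite ltr_wpDl// mulr_ge0.
suff main S : feasible I S -> cost I (service_algorithm I) <= alpha * cost I S.
  rewrite -ler_pdivrMl// mulrC; apply: lb_le_inf.
    by exists (cost I (service_algorithm I)), (service_algorithm I).
  by move=> _ [S fS <-]; rewrite ler_pdivrMr// mulrC main.
move=> fS; have vr := valid_input_requests vI.
rewrite (cost_actions feasA).
have share0 : 0 <= \sum_(i < size I) opt_share I S i.
  by apply: sumr_ge0 => i _; apply: opt_share_ge0.
have open0 : 0 <= \sum_(a <- S) opening (site a).
  by apply: sumr_ge0 => a _; apply: opening_ge0.
have [st [-> pst [hc hb [Y [hY hl]]] Est]] : exists st, [/\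
    service_algorithm I = log st, pend st = [::],
    [/\ cost_inv I st, base_inv I S st & charge_inv I S st] & reqs st = I].
  case EI: I => [|q J].
    exists (init_state G 0); split=> //.
    by rewrite -EI; apply: (reachable_inv vr fS (reach_init G 0)) EI.
  rewrite EI in vI; have [r1 E1] := run_reachable_input vI.
  have [r2 E2 p2] := finishP r1.
  exists (finish (run (init_state G (release q)) (q :: J))); split=> //.
    rewrite EI in vr fS.
    by apply: (reachable_inv vr fS r2 (J := [::])); rewrite cats0 E2 E1.
  by rewrite E2.
move: hc; rewrite /cost_inv pst big_nil addr0 Est => hc.
have hbase : \sum_(i < size I) delay_of I i (release_of I i) <=
    \sum_(i < size I) opt_share I S i.
  apply: ler_sum => i _; apply: (le_trans (y := opt_delay I S i)).
    have [a _ [_ at_ ra]] := opt_serves fS (ltn_ord i).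
    by apply: delay_of_mono; rewrite // -at_.
  by rewrite lerDl opt_dist_ge0.
have [T [_ _]] := hb; rewrite pst big_nil addr0 Est => hN0.
have [L hL] : exists L, all (fun m => m < L.+1)%N (hist st).
  exists (\max_(m <- hist st) m); apply/allP => m ms.
  by rewrite ltnS (big_rem m)//= leq_maxl.
have le_all (g : action G -> R) x : (forall a, 0 <= g a) ->
    \sum_(a <- S | time a < x) g a <= \sum_(a <- S) g a.
  move=> g0; rewrite big_mkcond; apply: ler_sum => a _.
  by case: ifP.
have hist_le : \sum_(m <- hist st) budget G m <=
    (\sum_(a <- S) opening (site a) + \sum_(i < size I) opt_share I S i) +
    2 * ((up_log 2 #|V| + 2)%:R * (\sum_(a <- S) opening (site a)) +
         \sum_(i < size I) opt_share I S i).
  rewrite (sum_by_count _ hL) big_ord_recl /=; apply: lerD.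
    apply: le_trans hN0 _; rewrite lerD2r le_all// => a; exact: opening_ge0.
  apply: (le_trans (y := \sum_(l < L)
      (2 * (\sum_(a <- S) capped_opening l a + Y l)))).
    apply: ler_sum => l _; have [T' [Z [_ ZY hN _ _]]] := hl l.
    rewrite /bump /= add1n budgetS -mulrnAr ler_pM2l//.
    apply: le_trans hN _; apply: lerD => //.
    by apply: le_all => a; apply: capped_opening_ge0.
  rewrite -mulr_sumr ler_pM2l// big_split /=; apply: lerD.
    rewrite exchange_big /= mulr_sumr; apply: ler_sum => a _.
    exact: sum_capped_opening_le.
  by have := hY L; rewrite pst big_nil addr0 Est.
apply: le_trans hc _; rewrite cost_shares.
apply: (le_trans (y := 2 * \sum_(i < size I) opt_share I S i +
  4 * ((\sum_(a <- S) opening (site a) + \sum_(i < size I) opt_share I S i) +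
    2 * ((up_log 2 #|V| + 2)%:R * (\sum_(a <- S) opening (site a)) +
         \sum_(i < size I) opt_share I S i)))).
  by apply: lerD; rewrite ler_pM2l.
rewrite /alpha natrD.
move: (\sum_(a <- S) _) (\sum_(i < _) _) share0 open0 => f s s0 f0.
have k0 : 0 <= (up_log 2 #|V|)%:R :> R by [].
have : 0 <= (up_log 2 #|V|)%:R * s by rewrite mulr_ge0.
by rewrite !mulrDl !mulrDr; lra.
Qed.

End Competitiveness.

Theorem theorem5p6 (R : realType) :
  exists (A : algorithm R) (alpha : nat -> R),
    [/\ online_algorithm A,
        competitive alpha A
      & alpha =O_\oo (fun n : nat => ln (n%:R : R))].
Proof.
exists (fun G => @service_algorithm R G), (fun n => 8 * (up_log 2 n)%:R + 22).
split; [exact: service_algorithm_online|exact: service_algorithm_competitive|].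
have ln2 : 0 < ln (2 : R) by rewrite ln_gt0// ltr1n.
(* 38 = 8 + 8 + 22: for [k = up_log 2 n], [(k - 1) ln 2 <= ln n] handles [8 (k - 1)], and
   [ln 2 <= ln n] absorbs the remaining [8 + 22]. *)
apply/eqO_exP; exists (38 / ln 2); first by rewrite divr_gt0.
exists 2%N => // n /= n2.
have n2R : 2 <= n%:R :> R by rewrite ler_nat.
have lnn : ln (2 : R) <= ln n%:R by rewrite ler_ln ?posrE// (lt_le_trans _ n2R).
rewrite ger0_norm ?addr_ge0 ?mulr_ge0// ger0_norm; last exact: le_trans (ltW ln2) lnn.
have hk : (up_log 2 n).-1%:R * ln 2 <= ln n%:R :> R.
  rewrite mulr_natl -lnXn// ler_ln ?posrE ?exprn_gt0//; last exact: lt_le_trans n2R.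
  by rewrite -natrX ler_nat ltnW // up_log_gtn.
rewrite mulrAC ler_pdivlMr//.
have k1 : (up_log 2 n)%:R <= (up_log 2 n).-1%:R + 1 :> R.
  by rewrite natr1 ler_nat leqSpred.
have : (up_log 2 n)%:R * ln 2 <= ((up_log 2 n).-1%:R + 1) * ln 2 :> R.
  by rewrite ler_pM2r.
by rewrite mulrDl mul1r; move: hk lnn; lra.
Qed.
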